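(* $\mathrm{HMEL}_0$-grammars are at least as expressive as DPO grammars: for every DPO hypergraph grammar $HGr$ there is an $\mathrm{HMEL}_0$-grammar generating $L(HGr)$.
   Context: A DPO grammar $\langle N,\Sigma,P,S^\bullet\rangle$ has rules $L\overset{\varphi_L}{\leftarrow}\mathrm{Dis}_k\overset{\varphi_R}{\rightarrow}R$ with zero-rank $L,R$ and discrete interface $\mathrm{Dis}_k=\langle[k],\emptyset,\emptyset,\emptyset,\Lambda\rangle$ (the hypergraph with $k$ nodes, no hyperedges, no external nodes), applied by the double pushout approach; it generates all terminal hypergraphs derivable from $S^\bullet$. $\mathrm{HMEL}_0$ is the hypergraph Lambek calculus $\mathrm{HL}$ extended by the exponential modality $!A$, allowed only for types $A$ of rank $0$, with rules dereliction $(!\to)$, promotion $(\to!)$, weakening and contraction. An $\mathrm{HMEL}_0$-grammar $\langle\Sigma,S,\triangleright\rangle$ assigns finitely many types to each label and generates those hypergraphs $G$ that admit a type relabeling $f_G$ (respecting $\triangleright$) with $\mathrm{HMEL}_0\vdash f_G(G)\to S$. *)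

(* Defs.v *)
From HB Require Import structures.
From Stdlib Require List.
From Stdlib Require Import Relation_Operators.
From mathcomp Require Import all_boot.

Set Implicit Arguments.
Unset Strict Implicit.
Unset Printing Implicit Defensive.

(** A ranked set of labels is given by its fibres: [L n] is the set of labels of
    rank [n].  Ranks are tracked by typing, so that "the rank of the label of a
    hyperedge is the length of its attachment string" and "an [n]-ary hyperedge
    may only be replaced by a hypergraph of rank [n]" hold by construction.
    Attachment strings and strings of external nodes may contain repetitions. *)
Record hgraph (L : nat -> Type) (n : nat) := Hgraph {
  node : finType;
  edge : finType;
  ar : edge -> nat;
  att : forall e : edge, (ar e).-tuple node;
  lab : forall e : edge, L (ar e);
  ext : n.-tuple node
}.
Arguments ar {L n h}.
Arguments att {L n h}.
Arguments lab {L n h}.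
Arguments ext {L n}.

Section Hypergraphs.
Variable L : nat -> Type.

Record hmorph (n : nat) (G H : hgraph L n) := Hmorph {
  fnode : node G -> node H;
  fedge : edge G -> edge H;
  hmorph_att : forall e,
    map fnode (att e) = att (fedge e) :> seq (node H);
  hmorph_lab : forall e, Tagged L (lab (fedge e)) = Tagged L (lab e);
  hmorph_ext : map fnode (ext G) = ext H :> seq (node H)
}.

Definition hiso (n : nat) (G H : hgraph L n) : Prop :=
  exists f : hmorph G H, bijective (fnode f) /\ bijective (fedge f).

Definition dis (k : nat) : hgraph L 0 :=
  {| node := 'I_k; edge := void; ar := of_void nat;
     att := fun e => match e with end;
     lab := fun e => match e with end;
     ext := [tuple] |}.

(** The handle [a^•]: one hyperedge labelled [a], attached to [n] distinct
    nodes, which are also the external nodes in the same order. *)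
Definition handle (n : nat) (a : L n) : hgraph L n :=
  {| node := 'I_n; edge := unit; ar := fun _ => n;
     att := fun _ => ord_tuple n;
     lab := fun _ => a;
     ext := ord_tuple n |}.

Definition hempty : hgraph L 0 := dis 0.

(** [G + H]; only [G] may have external nodes. *)
Definition hsum (n : nat) (G : hgraph L n) (H : hgraph L 0) : hgraph L n :=
  let sum_ar (e : edge G + edge H) :=
    match e with inl d => ar d | inr d => ar d end in
  {| node := (node G + node H)%type;
     edge := (edge G + edge H)%type;
     ar := sum_ar;
     att := fun e => match e return (sum_ar e).-tuple _ with
       | inl d => map_tuple (@inl (node G) (node H)) (att d)
       | inr d => map_tuple (@inr (node G) (node H)) (att d)
       end;
     lab := fun e => match e return L (sum_ar e) with
       | inl d => lab d
       | inr d => lab d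
       end;
     ext := map_tuple (@inl (node G) (node H)) (ext G) |}.

End Hypergraphs.

Definition hrelab (L L' : nat -> Type) (n : nat) (G : hgraph L n)
    (f : forall e : edge G, L' (ar e)) : hgraph L' n :=
  {| node := node G; edge := edge G; ar := @ar L n G; att := @att L n G;
     lab := f; ext := ext G |}.

(** [hsubst G H] replaces every hyperedge [e] of [G] by a copy of [H e] and fuses
    the [i]-th external node of [H e] with the [i]-th attachment node of [e].
    Nodes are the classes of the equivalence generated by these fusions, each
    class being represented by its [root]. *)
Section Replacement.
Variables (L L' : nat -> Type) (n : nat) (G : hgraph L n).
Variable H : forall e : edge G, hgraph L' (ar e).

Definition prenode : finType := (node G + {e : edge G & node (H e)})%type.

Definition outer (v : node G) : prenode := inl v.
Definition inner (e : edge G) (v : node (H e)) : prenode :=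
  inr (Tagged (fun e => node (H e)) v).

Definition fuse : rel prenode := fun x y =>
  [exists e : edge G, [exists i : 'I_(ar e),
     (x == outer (tnth (att e) i)) && (y == inner (tnth (ext (H e)) i))]].

Definition fuse_sym : rel prenode := fun x y => fuse x y || fuse y x.

Lemma fuse_symC : connect_sym fuse_sym.
Proof. by apply: sym_connect_sym => x y; rewrite /fuse_sym orbC. Qed.

Definition fused : finType := {x : prenode | roots fuse_sym x}.

Definition fclass (x : prenode) : fused :=
  exist _ (root fuse_sym x) (roots_root fuse_symC x).

Definition hsubst : hgraph L' n :=
  {| node := fused;
     edge := {e : edge G & edge (H e)};
     ar := fun d => ar (tagged d);
     att := fun d => map_tuple (fun v => fclass (inner v)) (att (tagged d));
     lab := fun d => lab (tagged d);
     ext := map_tuple (fun v => fclass (outer v)) (ext G) |}.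

End Replacement.

(** [G[e/H]]; the other hyperedges are kept, that is, replaced by the handles of
    their labels. *)
Definition hrepl (L : nat -> Type) (n : nat) (G : hgraph L n) (e : edge G)
    (H : hgraph L (ar e)) : hgraph L n :=
  hsubst (dfwith (fun d : edge G => handle (lab d)) H).
Arguments hrepl {L n G} e H.

(** [dedge D] is the set of the hyperedges of [D] other than the [$]-hyperedge;
    [dollar D] is the attachment string of the latter. *)
Record dgraph (L : nat -> Type) (k n : nat) := Dgraph {
  dnode : finType;
  dedge : finType;
  dar : dedge -> nat;
  datt : forall d : dedge, (dar d).-tuple dnode;
  dlab : forall d : dedge, L (dar d);
  dollar : k.-tuple dnode;
  dext : n.-tuple dnode
}.
Arguments dar {L k n d0}.
Arguments datt {L k n d0}.
Arguments dlab {L k n d0}.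
Arguments dollar {L k n}.
Arguments dext {L k n}.

(** The same hypergraph, with [None] in the role of the label [$]. *)
Definition dgraph_full (L : nat -> Type) (k n : nat) (D : dgraph L k n) :
    hgraph (fun m => option (L m)) n :=
  let full_ar (d : option (dedge D)) := if d is Some d' then dar d' else k in
  {| node := dnode D;
     edge := option (dedge D);
     ar := full_ar;
     att := fun d => match d return (full_ar d).-tuple _ with
       | Some d' => datt d'
       | None => dollar D
       end;
     lab := fun d => match d return option (L (full_ar d)) with
       | Some d' => Some (dlab d')
       | None => None
       end;
     ext := dext D |}.

(** [D[$/F, d_1/H_1, ..., d_l/H_l]]. *)
Definition dsubst (L : nat -> Type) (k n : nat) (D : dgraph L k n)
    (F : hgraph L k) (H : forall d : dedge D, hgraph L (dar d)) :
    hgraph L n :=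
  @hsubst _ L n (dgraph_full D)
    (fun d => match d return hgraph L (@ar _ _ (dgraph_full D) d) with
      | Some d' => H d'
      | None => F
      end).

Definition drepl (L : nat -> Type) (k n : nat) (D : dgraph L k n)
    (F : hgraph L k) : hgraph L n :=
  dsubst F (fun d : dedge D => handle (dlab d)).

(** [tp n] is the set of types of rank [n]; [Prim n i], for [i] in [nat], are the
    primitive types of rank [n].  [Div N D] is [N ÷ D], whose rank is that of the
    [$]-hyperedge of [D], and [Times M] is [×(M)]. *)
Inductive tp : nat -> Type :=
| Prim (n : nat) : nat -> tp n
| Div (k n : nat) : tp n -> dgraph tp k n -> tp k
| Times (n : nat) : hgraph tp n -> tp n
| Bang : tp 0 -> tp 0.

(** [!A_1^• + ... + !A_m^•]; it has no nodes. *)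
Definition bangs (As : seq (tp 0)) : hgraph tp 0 :=
  foldr (fun A G => hsum G (handle (Bang A))) (hempty tp) As.

(** [hmel0 H A] is derivability of the sequent [H -> A].  [Hmel0_iso] expresses
    that hypergraphs are considered up to isomorphism.  In the rules for [!], a
    hyperedge of rank 0 is a disjoint summand, so that [G + A^•] is an arbitrary
    hypergraph with a distinguished hyperedge labelled by [A]. *)
Inductive hmel0 : forall n : nat, hgraph tp n -> tp n -> Prop :=
| Hmel0_iso n (G H : hgraph tp n) (A : tp n) :
    hiso G H -> hmel0 G A -> hmel0 H A
| Hmel0_ax n (A : tp n) : hmel0 (handle A) A
| Hmel0_div_l n (G : hgraph tp n) (e : edge G) (B : tp n) k
    (N : tp (ar e)) (D : dgraph tp k (ar e))
    (H : forall d : dedge D, hgraph tp (dar d)) :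
    hmel0 (hrepl e (handle N)) B ->
    (forall d, hmel0 (H d) (dlab d)) ->
    hmel0 (hrepl e (dsubst (handle (Div N D)) H)) B
| Hmel0_div_r k n (F : hgraph tp k) (N : tp n) (D : dgraph tp k n) :
    hmel0 (drepl D F) N -> hmel0 F (Div N D)
| Hmel0_times_l n (G : hgraph tp n) (e : edge G) (B : tp n)
    (M : hgraph tp (ar e)) :
    hmel0 (hrepl e M) B -> hmel0 (hrepl e (handle (Times M))) B
| Hmel0_times_r n (M : hgraph tp n)
    (H : forall m : edge M, hgraph tp (ar m)) :
    (forall m, hmel0 (H m) (lab m)) -> hmel0 (hsubst H) (Times M)
| Hmel0_dereliction n (G : hgraph tp n) (A : tp 0) (B : tp n) :
    hmel0 (hsum G (handle A)) B -> hmel0 (hsum G (handle (Bang A))) B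
| Hmel0_promotion (As : seq (tp 0)) (B : tp 0) :
    hmel0 (bangs As) B -> hmel0 (bangs As) (Bang B)
| Hmel0_weakening n (G : hgraph tp n) (A : tp 0) (B : tp n) :
    hmel0 G B -> hmel0 (hsum G (handle (Bang A))) B
| Hmel0_contraction n (G : hgraph tp n) (A : tp 0) (B : tp n) :
    hmel0 (hsum (hsum G (handle (Bang A))) (handle (Bang A))) B ->
    hmel0 (hsum G (handle (Bang A))) B.

Record alphabet := Alphabet { symbol :> finType; rk : symbol -> nat }.
Arguments rk {a}.

Definition label (A : alphabet) (n : nat) : Type := {a : A | rk a == n}.

(** The tagged sum makes nonterminals and terminals disjoint. *)
Definition alphabet_sum (N T : alphabet) : alphabet :=
  @Alphabet (N + T)%type (fun a => match a with inl x => rk x | inr x => rk x end).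

Definition label_inr (N T : alphabet) (n : nat) (a : label T n) :
    label (alphabet_sum N T) n :=
  exist _ (inr (sval a)) (svalP a).

(** [a ▷ A] iff [A] is in the list [lexicon a]; a symbol is only assigned types
    of its own rank. *)
Record hmel0_grammar (T : alphabet) := Hmel0Grammar {
  lexicon : forall n : nat, label T n -> seq (tp n);
  goal_rank : nat;
  goal : tp goal_rank
}.
Arguments lexicon {T} h {n}.

Variant hmel0_language (T : alphabet) (Gr : hmel0_grammar T) :
    forall n : nat, hgraph (label T) n -> Prop :=
| Hmel0Language (G : hgraph (label T) (goal_rank Gr))
    (f : forall e : edge G, tp (ar e)) :
    (forall e, List.In (f e) (lexicon Gr (lab e))) ->
    hmel0 (hrelab f) (goal Gr) ->
    hmel0_language Gr G.

Definition commute_square (L : nat -> Type) (n : nat) (K A B P : hgraph L n)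
    (f : hmorph K A) (g : hmorph K B) (a : hmorph A P) (b : hmorph B P) : Prop :=
  (forall v, fnode a (fnode f v) = fnode b (fnode g v)) /\
  (forall e, fedge a (fedge f e) = fedge b (fedge g e)).

Definition factors (L : nat -> Type) (n : nat) (A P X : hgraph L n)
    (a : hmorph A P) (x : hmorph A X) (h : hmorph P X) : Prop :=
  (forall v, fnode h (fnode a v) = fnode x v) /\
  (forall e, fedge h (fedge a e) = fedge x e).

Definition pushout (L : nat -> Type) (n : nat) (K A B P : hgraph L n)
    (f : hmorph K A) (g : hmorph K B) (a : hmorph A P) (b : hmorph B P) : Prop :=
  commute_square f g a b /\
  forall (X : hgraph L n) (x : hmorph A X) (y : hmorph B X),
    commute_square f g x y ->
    exists h : hmorph P X,
      [/\ factors a x h, factors b y h &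
          forall h' : hmorph P X, factors a x h' -> factors b y h' ->
            fnode h' =1 fnode h /\ fedge h' =1 fedge h].

(** No injectivity is required of the two legs of a rule nor of a match. *)
Record dpo_rule (L : nat -> Type) := DpoRule {
  interface : nat;
  lhs : hgraph L 0;
  rhs : hgraph L 0;
  phiL : hmorph (dis L interface) lhs;
  phiR : hmorph (dis L interface) rhs
}.

Definition dpo_apply (L : nat -> Type) (r : dpo_rule L) (G H : hgraph L 0) : Prop :=
  exists (C : hgraph L 0) (c : hmorph (dis L (interface r)) C)
         (mG : hmorph (lhs r) G) (cG : hmorph C G)
         (mH : hmorph (rhs r) H) (cH : hmorph C H),
    pushout (phiL r) c mG cG /\ pushout (phiR r) c mH cH.

(** The start hypergraph is an arbitrary hypergraph of rank 0, in particular it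
    may be the handle of a nonterminal of rank 0. *)
Record dpo_grammar (T : alphabet) := DpoGrammar {
  nonterminal : alphabet;
  rules : seq (dpo_rule (label (alphabet_sum nonterminal T)));
  start : hgraph (label (alphabet_sum nonterminal T)) 0
}.

Definition dpo_step (T : alphabet) (Gr : dpo_grammar T)
    (G H : hgraph (label (alphabet_sum (nonterminal Gr) T)) 0) : Prop :=
  exists r, List.In r (rules Gr) /\ dpo_apply r G H.

Definition dpo_derives (T : alphabet) (Gr : dpo_grammar T) :=
  clos_refl_trans _ (@dpo_step T Gr).

Variant dpo_language (T : alphabet) (Gr : dpo_grammar T) :
    forall n : nat, hgraph (label T) n -> Prop :=
| DpoLanguage (G : hgraph (label T) 0) K :
    dpo_derives (start Gr) K ->
    hiso K (hrelab (fun e : edge G => label_inr (nonterminal Gr) (lab e))) ->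
    dpo_language Gr G.

(* Main.v *)
(** The grammar assigns to each symbol a primitive type, to each rule
    [L <- Dis_k -> R] the rank-0 type [A_r := ×(L) ÷ ($ + R)], where [L] and [R]
    have the images of the interface nodes as external nodes, and takes as goal
    [×(start) ÷ ($ + !A_1 + ... + !A_m)] (one division per rule).

    A pushout along [Dis_k] is the fusion [glue C X] of two hypergraphs of rank [k]
    along their external nodes, so that a DPO step leads from [glue C L] to
    [glue C R].  Read from bottom to top, a copy of [!A_r] allows a sequent to
    undo such a step; this gives completeness.

    Soundness needs no cut elimination.  For hypergraphs of rank [n], let [K <= K']
    mean that [glue C K'] is derivable from [glue C K] for every [C].  This preorder
    is a congruence for replacement.  Interpret types by upward closed sets:
    [model p_a = {Y | a^• <= Y}], [model ×(M) = {Y | M[H] <= Y for some H in model}],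
    [model (N ÷ D) = {F | D[$/F, H] in model N for all H in model}], and [model !A] is
    [{Y | 0 <= Y}] if the empty hypergraph [0] is in [model A], and empty otherwise.
    All rules of the calculus are valid in this model, and [0] is in [model A_r]. *)
From HB Require Import structures.
From Stdlib Require List.
From Stdlib Require Import Relation_Operators Operators_Properties.
Require Import Defs.
From mathcomp Require Import all_boot.

Set Implicit Arguments.
Unset Strict Implicit.
Unset Printing Implicit Defensive.

(** * Isomorphisms of hypergraphs *)

Section Isomorphism.
Variable L : nat -> Type.

Lemma hisoI n (G H : hgraph L n) (f : node G -> node H) (g : edge G -> edge H) :
    bijective f -> bijective g ->
    (forall e, map f (att e) = att (g e) :> seq _) ->
    (forall e, Tagged L (lab (g e)) = Tagged L (lab e)) ->
    map f (ext G) = ext H :> seq _ ->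
  hiso G H.
Proof. by move=> bf bg fa fl fe; exists (Hmorph fa fl fe). Qed.

Lemma hiso_refl n (G : hgraph L n) : hiso G G.
Proof.
by apply: (@hisoI _ _ _ id id) => [||e||]; rewrite ?map_id //; exists id.
Qed.

Lemma hisoE n (G H : hgraph L n) : hiso G H ->
  exists (f : hmorph G H) (g : hmorph H G),
    [/\ cancel (fnode f) (fnode g), cancel (fnode g) (fnode f),
        cancel (fedge f) (fedge g) & cancel (fedge g) (fedge f)].
Proof.
case=> f [[f' fK f'K] [g gK g'K]].
have fa e : map f' (att e) = att (g e) :> seq (node G).
  have [d ->] : exists d, e = fedge f d by exists (g e).
  by rewrite gK -hmorph_att -map_comp (eq_map (g := id)) ?map_id.
have fl e : Tagged L (lab (g e)) = Tagged L (lab e).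
  have [d ->] : exists d, e = fedge f d by exists (g e).
  by rewrite gK hmorph_lab.
have fx : map f' (ext H) = ext G :> seq (node G).
  by rewrite -(hmorph_ext f) -map_comp (eq_map (g := id)) ?map_id.
by exists f, (Hmorph fa fl fx).
Qed.

Lemma hiso_sym n (G H : hgraph L n) : hiso G H -> hiso H G.
Proof.
by case/hisoE=> f [g [? ? ? ?]]; exists g; split; [exists (fnode f)|exists (fedge f)].
Qed.

Lemma hiso_trans n (G H K : hgraph L n) : hiso G H -> hiso H K -> hiso G K.
Proof.
case=> f [bf bfe] [g [bg bge]].
apply: (@hisoI _ _ _ (fnode g \o fnode f) (fedge g \o fedge f)) => [||e|e|].
- exact: bij_comp.
- exact: bij_comp.
- by rewrite map_comp hmorph_att hmorph_att.
- by rewrite /= !hmorph_lab.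
by rewrite map_comp !hmorph_ext.
Qed.

End Isomorphism.

Lemma map_tuple_eqP (X A B : Type) n (f : A -> X) (g : B -> X)
    (s : n.-tuple A) (t : n.-tuple B) :
  map f s = map g t <-> forall i, f (tnth s i) = g (tnth t i).
Proof.
split=> [E i|E].
  have /(congr1 (fun u => tnth u i)) : map_tuple f s = map_tuple g t by exact/val_inj.
  by rewrite !tnth_map.
by apply: (congr1 val (x := map_tuple f s) (y := map_tuple g t));
  apply: eq_from_tnth => i; rewrite !tnth_map.
Qed.

Section Universal.
Variables (L L' : nat -> Type) (n : nat) (G : hgraph L n).
Variable H : forall e : edge G, hgraph L' (ar e).

Definition onode (v : node G) : node (hsubst H) := fclass (outer H v).
Definition inode (e : edge G) (v : node (H e)) : node (hsubst H) :=
  fclass (inner v).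
Definition iedge (e : edge G) (d : edge (H e)) : edge (hsubst H) :=
  Tagged (fun e => edge (H e)) d.

Lemma fuse_node e :
  map onode (att e) = map (@inode e) (ext (H e)) :> seq (node (hsubst H)).
Proof.
apply/map_tuple_eqP => i; apply/val_inj/eqP => /=.
rewrite root_connect; last exact: fuse_symC.
apply/connect1/orP; left; apply/existsP; exists e; apply/existsP; exists i.
by rewrite !eqxx.
Qed.

(** Every node of [hsubst H] is the class of its own root, and the root is an outer or an inner
    prenode. *)
Lemma hsubst_node_ind (P : node (hsubst H) -> Prop) :
  (forall v, P (onode v)) -> (forall e v, P (@inode e v)) -> forall v, P v.
Proof.
move=> Po Pi v.
have -> : v = fclass (val v) by apply/val_inj/esym/eqP/(valP v).
by case: (val v) => [u|[e u]]; [apply: Po | apply: Pi].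
Qed.

Variables (X : Type) (o : node G -> X) (i : forall e, node (H e) -> X).
Arguments i : clear implicits.

Definition prelift (x : prenode H) : X :=
  match x with inl u => o u | inr u => i (tag u) (tagged u) end.
Definition hlift (v : node (hsubst H)) : X := prelift (val v).

Hypothesis oi : forall e, map o (att e) = map (i e) (ext (H e)).

(** Compatibility makes [prelift] agree at the two ends of each fusion, hence along every path to
    the root. So [hlift], which evaluates at the root, takes the prescribed values on all
    prenodes. *)
Lemma prelift_root x : prelift (root (fuse_sym (H := H)) x) = prelift x.
Proof.
have fuseE a b : fuse (H := H) a b -> prelift a = prelift b.
  case/existsP=> e /existsP[j /andP[/eqP-> /eqP->]] /=.
  by have /map_tuple_eqP/(_ j) := oi e.
have pathE a p : path (fuse_sym (H := H)) a p -> prelift (last a p) = prelift a.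
  elim: p a => [//|y p IHp] a /= /andP[ay yp].
  by rewrite IHp //; case/orP: ay => /fuseE.
by have /connectP[p xp ->] := connect_root (fuse_sym (H := H)) x; exact: pathE.
Qed.

Lemma hliftO v : hlift (onode v) = o v.
Proof. exact: prelift_root. Qed.
Lemma hliftI e v : hlift (@inode e v) = i e v.
Proof. exact: prelift_root. Qed.

End Universal.
Arguments inode {L L' n G} H e v.
Arguments onode {L L' n G} H v.
Arguments iedge {L L' n G} H e d.
Arguments hlift {L L' n G H X} o i v.

(** * Associativity and congruence of replacement *)

Section Associativity.
Variables (L1 L2 L3 : nat -> Type) (n : nat) (G : hgraph L1 n).
Variable H : forall e : edge G, hgraph L2 (ar e).
Variable K : forall d : edge (hsubst H), hgraph L3 (ar d).

Let K1 (e : edge G) (d : edge (H e)) : hgraph L3 (ar d) := K (iedge H e d).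
Let HK (e : edge G) : hgraph L3 (ar e) := hsubst (K1 (e := e)).

Let f1 : node (hsubst H) -> node (hsubst HK) :=
  hlift (onode HK) (fun e v => inode HK e (onode (K1 (e := e)) v)).
Let f2 (d : edge (hsubst H)) : node (K d) -> node (hsubst HK) :=
  match d return node (K d) -> node (hsubst HK) with
    existT e d' => fun u => inode HK e (inode (K1 (e := e)) d' u)
  end.
Let f : node (hsubst K) -> node (hsubst HK) := hlift f1 f2.

Let g1 (e : edge G) : node (HK e) -> node (hsubst K) :=
  hlift (fun v => onode K (inode H e v)) (fun d u => inode K (iedge H e d) u).
Let g : node (hsubst HK) -> node (hsubst K) :=
  hlift (fun v => onode K (onode H v)) g1.

(** Both sides are the same iterated quotient. The node maps [f] and [g] are lifts, so that they are
    mutually inverse need only be checked on the classes of the nodes of [G], of [H e] and of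
    [K d]. *)
Lemma hsubst_assoc :
  hiso (hsubst K) (hsubst (fun e => hsubst (fun d => K (iedge H e d)))).
Proof.
have f1E e : map (onode HK) (att e) =
    map (fun v => inode HK e (onode (K1 (e := e)) v)) (ext (H e)).
  by rewrite fuse_node [in LHS]/= -map_comp.
have f2E d : map f1 (att d) = map (f2 (d := d)) (ext (K d)).
  case: d => e d /=; rewrite -map_comp (eq_map (hliftI f1E (e := e))).
  rewrite [LHS](map_comp (inode HK e)).
  by rewrite -[att _]/(att d) (fuse_node (K1 (e := e))) -map_comp.
have g1E e d : map (fun v => onode K (inode H e v)) (att d) =
   map (inode K (iedge H e d)) (ext (K (iedge H e d))).
  by rewrite -fuse_node [in RHS]/= -map_comp.
have gE e : map (fun v => onode K (onode H v)) (att e) =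
    map (g1 (e := e)) (ext (HK e)).
  rewrite [in RHS]/= -map_comp (eq_map (hliftO (g1E e))).
  by rewrite [LHS](map_comp (onode K)) fuse_node -map_comp.
have fO v : f (onode K v) = f1 v := hliftO f2E v.
have fI d v : f (inode K d v) = f2 v := hliftI f2E v.
have gO v : g (onode HK v) = onode K (onode H v) := hliftO gE v.
have gI e v : g (inode HK e v) = g1 v := hliftI gE v.
have f1O v : f1 (onode H v) = onode HK v := hliftO f1E v.
have f1I e v : f1 (inode H e v) = inode HK e (onode _ v) := hliftI f1E v.
have g1O e v : g1 (onode (K1 (e := e)) v) = onode K (inode H e v) :=
  hliftO (g1E e) v.
have g1I e d v : g1 (inode (K1 (e := e)) d v) = inode K (iedge H e d) v :=
  hliftI (g1E e) v.
apply: (@hisoI _ _ _ _ f (fun x : {d : edge (hsubst H) & edge (K d)} =>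
  match x return edge (hsubst HK) with existT d k =>
    (match d return edge (K d) -> edge (hsubst HK) with
     existT e d' => fun k => iedge HK e (iedge (K1 (e := e)) d' k) end) k end)).
- exists g.
    elim/hsubst_node_ind => [v|[e d] v]; last by rewrite fI gI g1I.
    by rewrite fO; elim/hsubst_node_ind: v => [v|e v];
      rewrite ?f1O ?gO // f1I gI g1O.
  elim/hsubst_node_ind => [v|e v]; first by rewrite gO fO f1O.
  by rewrite gI; elim/hsubst_node_ind: v => [v|d v];
    rewrite ?g1O ?fO ?f1I // g1I fI.
- exists (fun x : {e : edge G & edge (HK e)} =>
   match x with existT e (existT d k) => iedge K (iedge H e d) k end).
    by case=> [[e d] k].
  by case=> [e [d k]].
- case=> [[e d] k] /=; rewrite -!map_comp; apply: eq_map => v /=.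
  by rewrite fI.
- by case=> [[e d] k].
rewrite /= -!map_comp; apply: eq_map => v /=.
by rewrite fO f1O.
Qed.

End Associativity.

(** Isomorphism of hypergraphs whose ranks are only propositionally equal. *)
Definition hheq (L : nat -> Type) (n m : nat) (A : hgraph L n) (B : hgraph L m) :=
  exists (c : node A -> node B) (ce : edge A -> edge B),
    [/\ bijective c, bijective ce,
        forall e, map c (att e) = att (ce e) :> seq (node B),
        forall e, Tagged L (lab (ce e)) = Tagged L (lab e) &
        map c (ext A) = ext B :> seq (node B)].

Lemma hiso_hheq L n (A B : hgraph L n) : hiso A B -> hheq A B.
Proof.
case=> f [bf bfe]; exists (fnode f), (fedge f); split=> //.
- exact: hmorph_att.
- exact: hmorph_lab.
exact: hmorph_ext.
Qed.

Lemma hheq_sym L n m (A : hgraph L n) (B : hgraph L m) : hheq A B -> hheq B A.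
Proof.
case=> f [g [[f' fK f'K] [g' gK g'K] fa fl fx]]; exists f', g'; split.
- by exists f.
- by exists g.
- move=> e; have [d ->] : exists d, e = g d by exists (g' e).
  by rewrite gK -fa -map_comp (eq_map (g := id)) ?map_id.
- move=> e; have [d ->] : exists d, e = g d by exists (g' e).
  by rewrite gK fl.
by rewrite -fx -map_comp (eq_map (g := id)) ?map_id.
Qed.

Lemma surj_card_bij (A B : finType) (f : A -> B) :
  (forall y, exists x, y = f x) -> #|A| <= #|B| -> bijective f.
Proof.
move=> fS cardAB; have [g gK] := fin_all_exists fS.
have {}gK : cancel g f by move=> y; rewrite -gK.
apply: (bij_can_bij (f := g)) => //.
exact: inj_card_bij (can_inj gK) cardAB.
Qed.

Lemma surj_leq_card (A B : finType) (f : A -> B) :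
  (forall y, exists x, y = f x) -> #|B| <= #|A|.
Proof.
move=> fS; have [g gK] := fin_all_exists fS.
by apply: (@leq_card _ _ g); apply: (can_inj (g := f)) => y; rewrite -gK.
Qed.

Lemma hsubst_map (L1 L2 L' : nat -> Type) n (G1 : hgraph L1 n) (G2 : hgraph L2 n)
    (H1 : forall e : edge G1, hgraph L' (ar e))
    (H2 : forall e : edge G2, hgraph L' (ar e))
    (f : node G1 -> node G2) (fe : edge G1 -> edge G2) :
    bijective f -> bijective fe ->
    (forall e, map f (att e) = att (fe e) :> seq (node G2)) ->
    map f (ext G1) = ext G2 :> seq (node G2) ->
    (forall e, hheq (H1 e) (H2 (fe e))) ->
  exists (h : node (hsubst H1) -> node (hsubst H2))
         (he : edge (hsubst H1) -> edge (hsubst H2)),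
    [/\ forall y, exists x, y = h x, forall y, exists x, y = he x,
        forall e, map h (att e) = att (he e) :> seq (node (hsubst H2)),
        forall e, Tagged L' (lab (he e)) = Tagged L' (lab e) &
        map h (ext (hsubst H1)) = ext (hsubst H2) :> seq (node (hsubst H2))].
Proof.
move=> [f' fK f'K] [fe' feK fe'K] fa fx HH.
have [c /fin_all_exists[ce cP]] := fin_all_exists HH.
have oi e : map (onode H2 \o f) (att e) =
    map (inode H2 (fe e) \o c e) (ext (H1 e)).
  by have [_ _ _ _ cx] := cP e; rewrite map_comp fa [RHS]map_comp cx fuse_node.
exists (hlift (onode H2 \o f) (fun e => inode H2 (fe e) \o c e)).
exists (fun x : {e & edge (H1 e)} =>
  match x with existT e d => iedge H2 (fe e) (ce e d) end).
split.
- elim/hsubst_node_ind => [v|e v].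
    by exists (onode H1 (f' v)); rewrite (hliftO oi) /= f'K.
  (* Writing [e] as [fe d] lets the bijection chosen for [d] be inverted without a transport between
     hyperedges. *)
  have [d eE] : exists d, e = fe d by exists (fe' e).
  subst e; have [[c' cK c'K] _ _ _ _] := cP d.
  by exists (inode H1 d (c' v)); rewrite (hliftI oi) /= c'K.
- case=> e k; have [d eE] : exists d, e = fe d by exists (fe' e).
  subst e; have [_ [ce' ceK ce'K] _ _ _] := cP d.
  by exists (iedge H1 d (ce' k)); rewrite /= ce'K.
- case=> e d /=; have [_ _ ca _ _] := cP e.
  by rewrite -ca -!map_comp; apply: eq_map => v; rewrite /= (hliftI oi).
- by case=> e d /=; have [_ _ _ cl _] := cP e; rewrite cl.
by rewrite /= -fx -!map_comp; apply: eq_map => v; rewrite /= (hliftO oi).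
Qed.

(** Surjections in both directions suffice, which spares an inverse of [hsubst_map]
    along dependent casts. *)
Lemma hsubst_congr (L1 L2 L' : nat -> Type) n (G1 : hgraph L1 n) (G2 : hgraph L2 n)
    (H1 : forall e : edge G1, hgraph L' (ar e))
    (H2 : forall e : edge G2, hgraph L' (ar e))
    (f : node G1 -> node G2) (fe : edge G1 -> edge G2) :
    bijective f -> bijective fe ->
    (forall e, map f (att e) = att (fe e) :> seq (node G2)) ->
    map f (ext G1) = ext G2 :> seq (node G2) ->
    (forall e, hheq (H1 e) (H2 (fe e))) ->
  hiso (hsubst H1) (hsubst H2).
Proof.
move=> bf bfe fa fx HH.
have [h [he [hS heS ha hl hx]]] := hsubst_map bf bfe fa fx HH.
case: (bf) (bfe) => f' fK f'K [fe' feK fe'K].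
have fa' e : map f' (att e) = att (fe' e) :> seq (node G1).
  have [d ->] : exists d, e = fe d by exists (fe' e).
  by rewrite feK -fa -map_comp (eq_map (g := id)) ?map_id.
have fx' : map f' (ext G2) = ext G1 :> seq (node G1).
  by rewrite -fx -map_comp (eq_map (g := id)) ?map_id.
have HH' e : hheq (H2 e) (H1 (fe' e)).
  have [d eE] : exists d, e = fe d by exists (fe' e).
  by subst e; rewrite feK; apply/hheq_sym/HH.
have bf' : bijective f' by exists f.
have bfe' : bijective fe' by exists fe.
(* The reverse maps only bound cardinalities: a surjection of finite sets onto a set that is no
   smaller is a bijection. *)
have [h' [he' [/surj_leq_card hS' /surj_leq_card heS' _ _ _]]] :=
  hsubst_map bf' bfe' fa' fx' HH'.
by apply: hisoI ha hl hx; apply: surj_card_bij.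
Qed.

Lemma hsubst_congr_id (L1 L' : nat -> Type) n (G : hgraph L1 n)
    (H1 H2 : forall e : edge G, hgraph L' (ar e)) :
  (forall e, hiso (H1 e) (H2 e)) -> hiso (hsubst H1) (hsubst H2).
Proof.
move=> HH; apply: (@hsubst_congr _ _ _ _ _ _ _ _ id id).
- by exists id.
- by exists id.
- by move=> e; rewrite map_id.
- by rewrite map_id.
by move=> e; apply/hiso_hheq/HH.
Qed.

(** * Handles as units of replacement *)

Lemma map_tnth_ord (X Y : Type) n (o : X -> Y) (t : n.-tuple X) :
  map (fun j => o (tnth t j)) (ord_tuple n) = map o t.
Proof. by rewrite (map_comp o) map_tnth_enum. Qed.

Lemma map_ord_tuple (Y : Type) n (o : 'I_n -> Y) (t : n.-tuple Y) :
  (forall j, o j = tnth t j) -> map o (ord_tuple n) = t.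
Proof. by move=> /eq_map->; rewrite map_tnth_enum. Qed.

Section Identities.
Variables (L1 L : nat -> Type).

(** Node [j] of the handle is fused with the [j]-th external node of [K], so every class contains
    exactly one node of [K]. *)
Lemma hsubst_handle n (A : L1 n) (K : hgraph L n) :
  hiso (hsubst (G := handle A) (fun=> K)) K.
Proof.
set H := fun=> K.
have oi (e : edge (handle A)) : map (tnth (ext K)) (att e) = map id (ext (H e)).
  by rewrite map_tnth_enum map_id.
pose f := hlift (H := H) (tnth (ext K)) (fun=> id).
apply: (@hisoI _ _ _ _ f
   (fun x : {e : edge (handle A) & edge (H e)} => tagged x)).
- exists (inode H tt).
    elim/hsubst_node_ind => [v|[] v]; last by rewrite /f (hliftI oi).
    rewrite /f (hliftO oi).
    by have /map_tuple_eqP/(_ v) := fuse_node H tt; rewrite tnth_ord_tuple => <-.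
  by move=> v; rewrite /f (hliftI oi).
- by exists (iedge H tt) => [[[] d]|d].
- case=> [[] d] /=; rewrite -!map_comp -[RHS]map_id; apply: eq_map => v /=.
  by rewrite /f (hliftI oi).
- by case=> [[] d].
change (map f (map (onode H) (ord_tuple n)) = ext K).
by rewrite -map_comp; apply: map_ord_tuple => v; exact: (hliftO oi).
Qed.

(** The nodes of the handle that replaces [e] are fused with the attachment nodes of [e], so every
    class contains exactly one node of [G]. *)
Lemma hsubst_handles n (G : hgraph L n) (H := fun e : edge G => handle (lab e)) :
  hiso (hsubst H) G.
Proof.
have oi (e : edge G) : map id (att e) = map (tnth (att e)) (ext (H e)).
  by rewrite map_tnth_enum map_id.
pose f := hlift (H := H) id (fun e => tnth (att e)).
apply: (@hisoI _ _ _ _ f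
   (fun x : {e : edge G & edge (H e)} => tag x)).
- exists (onode H).
    elim/hsubst_node_ind => [v|e v]; first by rewrite /f (hliftO oi).
    rewrite /f (hliftI oi).
    by have /map_tuple_eqP/(_ v) := fuse_node H e; rewrite tnth_ord_tuple => ->.
  by move=> v; rewrite /f (hliftO oi).
- by exists (fun e => iedge H e tt) => [[e []]|e].
- case=> [e []]; change (map f (map (inode H e) (ord_tuple _)) = att e).
  by rewrite -map_comp; apply: map_ord_tuple => v; exact: (hliftI oi).
- by case=> [e []].
rewrite /= -!map_comp -[RHS]map_id; apply: eq_map => v /=.
by rewrite /f (hliftO oi).
Qed.

End Identities.

(** * Gluing along external nodes *)

Lemma map_tuple0 (X Y A : Type) (f : A -> X) (s : 0.-tuple A) (g : Y -> X)
  (t : 0.-tuple Y) : map f s = map g t.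
Proof. by rewrite (tuple0 s) (tuple0 t). Qed.

Lemma map_tuple0E (X A : Type) (f : A -> X) (s : 0.-tuple A) (t : 0.-tuple X) :
  map f s = t.
Proof. by rewrite (tuple0 s) (tuple0 t). Qed.

(** [glue X Y] fuses the external nodes of [X] with those of [Y] and has no
    external nodes. *)
Section Glue.

(** Two parallel hyperedges on the same [n] nodes. Replacing them by [X] and [Y] performs the
    gluing, so [glue] inherits its universal property and its congruence from [hsubst]. *)
Definition pairctx (n : nat) : hgraph (fun=> unit) 0 :=
  {| node := 'I_n; edge := bool; ar := fun=> n; att := fun=> ord_tuple n;
     lab := fun=> tt; ext := [tuple] |}.

Variables (L : nat -> Type) (n : nat) (X Y : hgraph L n).

Definition pairfam (b : edge (pairctx n)) : hgraph L (ar b) :=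
  if b then X else Y.

Definition glue : hgraph L 0 := hsubst pairfam.

Definition gl : node X -> node glue := inode pairfam true.
Definition gr : node Y -> node glue := inode pairfam false.
Definition gle : edge X -> edge glue := iedge pairfam true.
Definition gre : edge Y -> edge glue := iedge pairfam false.

Lemma glue_att : map gl (ext X) = map gr (ext Y).
Proof. by rewrite -(fuse_node pairfam true) -(fuse_node pairfam false). Qed.

Lemma glue_ind (P : node glue -> Prop) :
  (forall v, P (gl v)) -> (forall v, P (gr v)) -> forall v, P v.
Proof.
move=> Pl Pr; elim/hsubst_node_ind => [v|[] v]; [|exact: Pl|exact: Pr].
(* A node of [pairctx] is fused with an external node of [X] and so adds no class. *)
have /map_tuple_eqP/(_ v) := fuse_node pairfam true.
by rewrite tnth_ord_tuple => ->; apply: Pl.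
Qed.

Variables (T : Type) (a : node X -> T) (b : node Y -> T).

Definition gliftfam (e : edge (pairctx n)) : node (pairfam e) -> T :=
  match e return node (pairfam e) -> T with true => a | false => b end.

Definition glift : node glue -> T :=
  hlift (H := pairfam) (fun i => a (tnth (ext X) i)) gliftfam.

Hypothesis ab : map a (ext X) = map b (ext Y).

Let oi (e : edge (pairctx n)) : map (fun i => a (tnth (ext X) i)) (att e) =
  map (@gliftfam e) (ext (pairfam e)).
Proof. by rewrite (map_comp a) map_tnth_enum; case: e. Qed.

Lemma gliftl v : glift (gl v) = a v.
Proof. exact: (hliftI oi (e := true)). Qed.

Lemma gliftr v : glift (gr v) = b v.
Proof. exact: (hliftI oi (e := false)). Qed.

End Glue.
Arguments gl {L n} X Y v.
Arguments gr {L n} X Y v.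
Arguments gle {L n} X Y v.
Arguments gre {L n} X Y v.
Arguments glift {L n X Y T} a b v.

Section GlueIso.
Variable L : nat -> Type.

Lemma glue_congr n (X X' Y Y' : hgraph L n) :
  hiso X X' -> hiso Y Y' -> hiso (glue X Y) (glue X' Y').
Proof. by move=> XX' YY'; apply: hsubst_congr_id => -[]. Qed.

Lemma glueC n (X Y : hgraph L n) : hiso (glue X Y) (glue Y X).
Proof.
apply: (@hsubst_congr _ _ _ _ (pairctx n) (pairctx n) _ _ id negb) => //=.
- by exists id.
- by exists negb; apply: negbK.
- by move=> e; rewrite map_id.
by case; apply/hiso_hheq/hiso_refl.
Qed.

Lemma glue0 (X : hgraph L 0) : hiso (glue (hempty L) X) X.
Proof.
pose a : node (hempty L) -> node X := fun v => match notF (ltn_ord v) with end.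
have ab : map a (ext (hempty L)) = map id (ext X) by exact: map_tuple0.
apply: (@hisoI _ _ _ _ (glift a id) (fun x : edge (glue _ _) =>
   match x with existT b d =>
     (if b is true as b return edge (pairfam (hempty L) X b) -> edge X
      then of_void _ else id) d end)).
- exists (gr _ _); last by move=> v; rewrite (gliftr ab).
  by elim/glue_ind => [[]//|v]; rewrite (gliftr ab).
- by exists (gre _ _) => // -[[] d]; first by case: d.
- case=> [[] d]; first by case: d.
  rewrite /=  -map_comp -[RHS]map_id; apply: eq_map => v /=.
  by rewrite (gliftr ab).
- by case=> [[] d]; first by case: d.
exact: map_tuple0E.
Qed.

End GlueIso.

(** * Contexts with a hole, and moving them across a gluing *)

(** [dsubst] with the labels of [D] and those of the result kept apart. *)
Section Plug.
Variables (L1 L : nat -> Type) (k n : nat) (D : dgraph L1 k n).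

Definition plugfam (F : hgraph L k) (H : forall d : dedge D, hgraph L (dar d))
    (d : edge (dgraph_full D)) : hgraph L (ar d) :=
  match d return hgraph L (@ar _ _ (dgraph_full D) d) with
  | Some d' => H d'
  | None => F
  end.

Definition plug F H : hgraph L n := hsubst (plugfam F H).

Lemma plug_congr F F' H H' :
  hiso F F' -> (forall d, hiso (H d) (H' d)) -> hiso (plug F H) (plug F' H').
Proof. by move=> FF' HH'; apply: hsubst_congr_id => -[d|]; [apply: HH'|]. Qed.

(** The context [D] read from the outside: the hole and the external nodes change places. *)
Definition dflip : dgraph L1 n k :=
  {| dnode := dnode D; dedge := dedge D; dar := @dar _ _ _ D; datt := @datt _ _ _ D;
     dlab := @dlab _ _ _ D; dollar := dext D; dext := dollar D |}.

End Plug.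

Section Adjunction.
Variables (L1 L : nat -> Type) (k n : nat) (D : dgraph L1 k n).
Variables (C : hgraph L n) (F : hgraph L k).
Variable H : forall d : dedge D, hgraph L (dar d).

Let DF := plugfam (D := D) F H.
Let DC := plugfam (D := dflip D) C H.
Let P := glue C (plug F H).
Let Q := glue (plug (D := dflip D) C H) F.

Let f1 (d : edge (dgraph_full D)) : node (DF d) -> node Q :=
  match d with
  | Some d => fun v => gl _ _ (inode DC (Some d) v)
  | None => gr _ _
  end.
Let f2 : node (plug F H) -> node Q :=
  hlift (H := DF) (fun v => gl _ _ (onode DC v)) f1.
Let f : node P -> node Q := glift (fun v => gl _ _ (inode DC None v)) f2.

Let g1 (d : edge (dgraph_full (dflip D))) : node (DC d) -> node P :=
  match d with
  | Some d => fun v => gr _ _ (inode DF (Some d) v)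
  | None => gl _ _
  end.
Let g2 : node (plug (D := dflip D) C H) -> node P :=
  hlift (H := DC) (fun v => gr _ _ (onode DF v)) g1.
Let g : node Q -> node P := glift g2 (fun v => gr _ _ (inode DF None v)).

Let fe (x : edge P) : edge Q :=
  match x with
  | existT true c => gle (plug (D := dflip D) C H) F (iedge DC None c)
  | existT false (existT (Some d) c) => 
      gle (plug (D := dflip D) C H) F (iedge DC (Some d) c)
  | existT false (existT None c) => gre (plug (D := dflip D) C H) F c
  end.
Let ge (x : edge Q) : edge P :=
  match x with
  | existT true (existT None c) => gle C (plug F H) c
  | existT true (existT (Some d) c) => gre C (plug F H) (iedge DF (Some d) c)
  | existT false c => gre C (plug F H) (iedge DF None c)
  end.

(** Both sides attach [C], [F] and all the [H d] to the nodes of [D], and differ only in which part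
    counts as the context. *)
Lemma glue_plug : hiso P Q.
Proof.
have f2E (d : edge (dgraph_full D)) : map (fun v => gl _ _ (onode DC v)) (att d) =
    map (f1 (d := d)) (ext (DF d)).
  case: d => [d|] /=; last first.
    by rewrite -glue_att /= -map_comp.
  by rewrite [LHS](map_comp (gl _ _)) (fuse_node DC (Some d)) -map_comp.
have g2E (d : edge (dgraph_full (dflip D))) : map (fun v => gr _ _ (onode DF v)) (att d) =
    map (g1 (d := d)) (ext (DC d)).
  case: d => [d|] /=; last first.
    by rewrite glue_att /= -map_comp.
  by rewrite [LHS](map_comp (gr _ _)) (fuse_node DF (Some d)) -map_comp.
have f2O v : f2 (onode DF v) = gl _ _ (onode DC v) := hliftO f2E v.
have f2I d v : f2 (inode DF d v) = f1 v := hliftI f2E v.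
have g2O v : g2 (onode DC v) = gr _ _ (onode DF v) := hliftO g2E v.
have g2I d v : g2 (inode DC d v) = g1 v := hliftI g2E v.
have fE : map (fun v => gl _ _ (inode DC None v)) (ext C) =
    map f2 (ext (plug F H)).
  rewrite [LHS](map_comp (gl _ _)) -(fuse_node DC None) -!map_comp.
  by apply: eq_map => v; rewrite /= f2O.
have gE : map g2 (ext (plug (D := dflip D) C H)) =
    map (fun v => gr _ _ (inode DF None v)) (ext F).
  rewrite [RHS](map_comp (gr _ _)) -(fuse_node DF None) -!map_comp.
  by apply: eq_map => v; rewrite /= g2O.
have fl v : f (gl _ _ v) = gl _ _ (inode DC None v) := gliftl fE v.
have fr v : f (gr _ _ v) = f2 v := gliftr fE v.
have gll v : g (gl _ _ v) = g2 v := gliftl gE v.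
have grr v : g (gr _ _ v) = gr _ _ (inode DF None v) := gliftr gE v.
apply: (@hisoI _ _ _ _ f fe).
- exists g.
    elim/glue_ind => [v|]; first by rewrite fl gll g2I.
    elim/hsubst_node_ind => [v|[d|] v]; rewrite fr ?f2O ?gll ?g2O //.
      by rewrite f2I /= gll g2I.
    by rewrite f2I /= grr.
  elim/glue_ind => [|v]; last by rewrite grr fr f2I.
  elim/hsubst_node_ind => [v|[d|] v]; rewrite gll ?g2O ?fr ?f2O //.
    by rewrite g2I /= fr f2I.
  by rewrite g2I /= fl.
- by exists ge => [[[] //= [[d|] c]]|[[] //= [[d|] c]]].
- case=> [[] c] /=; first by rewrite -!map_comp; apply: eq_map => v /=; rewrite fl.
  by case: c => [[d|] c] /=; rewrite -!map_comp; apply: eq_map => v /=;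
    rewrite fr f2I.
- by case=> [[] //= [[d|] c]].
exact: map_tuple0E.
Qed.

End Adjunction.

Lemma id_bij (T : Type) : bijective (@id T).
Proof. by exists id. Qed.

(** * Disjoint sums *)

Section Sums.
Variable L : nat -> Type.

Lemma hsum_congr n (G G' : hgraph L n) (X X' : hgraph L 0) :
  hiso G G' -> hiso X X' -> hiso (hsum G X) (hsum G' X').
Proof.
case=> f [[f1 fK f1K] [f2 feK f2K]] [g [[g1 gK g1K] [g2 geK g2K]]].
pose m (A B C D : Type) (u : A -> C) (v : B -> D) (x : A + B) : C + D :=
  match x with inl a => inl (u a) | inr b => inr (v b) end.
apply: (@hisoI _ _ (hsum G X) (hsum G' X') (m _ _ _ _ (fnode f) (fnode g))
  (m _ _ _ _ (fedge f) (fedge g))).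
- by exists (m _ _ _ _ f1 g1); case=> v; rewrite /= ?fK ?f1K ?gK ?g1K.
- by exists (m _ _ _ _ f2 g2); case=> v; rewrite /= ?feK ?f2K ?geK ?g2K.
- by case=> e /=; rewrite -hmorph_att -!map_comp.
- by case=> e /=; rewrite hmorph_lab.
by rewrite /= -(hmorph_ext f) -!map_comp.
Qed.

Lemma hsum0 n (G : hgraph L n) : hiso (hsum G (hempty L)) G.
Proof.
have F (v : node (hempty L)) : False by case: (v).
pose f v := match v with inl v => v | inr v => False_rect _ (F v) end.
apply: (@hisoI _ _ (hsum G (hempty L)) G (f (node G))
          (fun e => match e with inl e => e | inr e => of_void _ e end)).
- by exists inl => // -[v|v] //; case: (F v).
- by exists inl => // -[e|[]].
- by case=> [e|[]] /=; rewrite -map_comp map_id.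
- by case=> [e|[]].
by rewrite /= -map_comp map_id.
Qed.

Lemma hsum_swap n (G : hgraph L n) (X Y : hgraph L 0) :
  hiso (hsum (hsum G X) Y) (hsum (hsum G Y) X).
Proof.
pose f A B C (x : A + B + C) : A + C + B :=
  match x with
  | inl (inl v) => inl (inl v) | inl (inr v) => inr v | inr v => inl (inr v)
  end.
have fK A B C : cancel (@f A B C) (@f A C B) by case=> [[]|].
apply: (@hisoI _ _ (hsum (hsum G X) Y) (hsum (hsum G Y) X)
  (@f (node G) (node X) (node Y))
  (@f (edge G) (edge X) (edge Y))).
- by exists (@f _ _ _).
- by exists (@f _ _ _).
- by case=> [[]|] e /=; rewrite -!map_comp.
- by case=> [[]|] e.
by rewrite /= -!map_comp.
Qed.

(** [A] has no external nodes to be fused, so it remains a summand outside the gluing. *)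
Lemma glue_hsum n (X Y : hgraph L n) (A : hgraph L 0) :
  hiso (glue X (hsum Y A)) (hsum (glue X Y) A).
Proof.
pose P := glue X (hsum Y A); pose Q := hsum (glue X Y) A.
pose a v : node Q := inl (gl X Y v).
pose b (v : node (hsum Y A)) : node Q :=
  match v with inl v => inl (gr X Y v) | inr v => inr v end.
have ab : map a (ext X) = map b (ext (hsum Y A)).
  by rewrite [LHS](map_comp inl) glue_att /= -!map_comp.
pose c (v : node (glue X Y)) : node P :=
  glift (gl X (hsum Y A)) (fun v => gr X (hsum Y A) (inl v)) v.
have cE : map (gl X (hsum Y A)) (ext X) =
    map (fun v => gr X (hsum Y A) (inl v)) (ext Y).
  by rewrite glue_att /= -map_comp.
pose fe (x : edge P) : edge Q :=
  match x with
  | existT true e => inl (gle X Y e)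
  | existT false (inl e) => inl (gre X Y e)
  | existT false (inr e) => inr e
  end.
apply: (@hisoI _ _ P Q (glift a b : node P -> node Q) fe).
- exists (fun v : node Q =>
    match v with inl v => c v | inr v => gr X (hsum Y A) (inr v) end).
    elim/glue_ind => [v|[v|v]]; rewrite ?(gliftl ab) ?(gliftr ab) //= /c.
      by rewrite (gliftl cE).
    by rewrite (gliftr cE).
  case=> [|v] /=; last by rewrite (gliftr ab).
  by elim/glue_ind => v; rewrite /c ?(gliftl cE) ?(gliftr cE)
    ?(gliftl ab) ?(gliftr ab).
- exists (fun x : edge Q => match x with
    | inl (existT true e) => gle X (hsum Y A) e
    | inl (existT false e) => gre X (hsum Y A) (inl e)
    | inr e => gre X (hsum Y A) (inr e)
    end : edge P); first by case=> [[] // []].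
  by case=> [[[] //]|].
- case=> [[] e] /=; last case: e => e /=; rewrite -!map_comp; apply: eq_map => v /=.
  + by rewrite (gliftl ab).
  + by rewrite (gliftr ab).
  by rewrite (gliftr ab).
- by case=> [[] // []].
exact: map_tuple0E.
Qed.

End Sums.

(** * Sums and gluings as contexts *)

Section Contexts.
Variables (L1 L : nat -> Type).

(** The context [$ + A^•]. It provides the divisions of the goal type, and it presents [hsum] as a
    plugging, from which monotonicity carries over. *)
Definition sumctx (n : nat) (A : L1 0) : dgraph L1 n n :=
  {| dnode := 'I_n; dedge := unit; dar := fun=> 0; datt := fun=> [tuple];
     dlab := fun=> A; dollar := ord_tuple n; dext := ord_tuple n |}.

Lemma plug_sumctx n (A : L1 0) (F : hgraph L n) (Y : hgraph L 0) :
  hiso (plug (D := sumctx n A) F (fun=> Y)) (hsum F Y).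
Proof.
set H := plugfam (D := sumctx n A) F (fun=> Y).
pose o (v : 'I_n) : node (hsum F Y) := inl (tnth (ext F) v).
pose i (d : edge (dgraph_full (sumctx n A))) : node (H d) -> node (hsum F Y) :=
  match d with Some _ => inr | None => inl end.
have oi (d : edge (dgraph_full (sumctx n A))) : map o (att d) = map (i d) (ext (H d)).
  by case: d => [[]|]; [apply: map_tuple0 | apply: map_tnth_ord].
pose f : node (hsubst H) -> node (hsum F Y) := hlift (H := H) o i.
have fO v : f (onode H v) = inl (tnth (ext F) v) := hliftO oi v.
have fI d v : f (inode H d v) = i d v := hliftI oi v.
apply: (@hisoI _ _ _ _ f (fun x : edge (hsubst H) => match x with
   existT None e => inl e | existT (Some tt) e => inr e end)).
- exists (fun v => match v with inl v => inode H None v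
                           | inr v => inode H (Some tt) v end).
    elim/hsubst_node_ind => [v|[[]|] v]; rewrite ?fO ?fI //=.
    have /map_tuple_eqP/(_ v) := fuse_node H None.
    by rewrite tnth_ord_tuple.
  by case=> v; rewrite fI.
- exists (fun v => match v with inl v => iedge H None v
                           | inr v => iedge H (Some tt) v end).
    by case=> [[[]|] e].
  by case.
- by case=> [[[]|] e] /=; rewrite -!map_comp; apply: eq_map => v /=; rewrite fI.
- by case=> [[[]|] e].
change (map f (map (onode H) (ord_tuple n)) = map inl (ext F)).
rewrite -map_comp (eq_map fO); exact: map_tnth_ord.
Qed.

(** [X] with a [$]-hyperedge on its external nodes. It presents gluing to [X] as the replacement of
    one hyperedge. *)
Definition hole k (X : hgraph L k) : dgraph L k 0 :=
  {| dnode := node X; dedge := edge X; dar := @ar _ _ X; datt := @att _ _ X;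
     dlab := @lab _ _ X; dollar := ext X; dext := [tuple] |}.

Lemma plug_hole k (X Y : hgraph L k) :
  hiso (plug (D := hole X) Y (fun d => handle (lab d))) (glue X Y).
Proof.
set H := plugfam (D := hole X) Y (fun d => handle (lab d)).
pose i (d : edge (dgraph_full (hole X))) : node (H d) -> node (glue X Y) :=
  match d with Some e => fun v => gl X Y (tnth (att e) v) | None => gr X Y end.
have oi (d : edge (dgraph_full (hole X))) : map (gl X Y) (att d) = map (i d) (ext (H d)).
  case: d => [d|] /=; last exact: glue_att.
  by rewrite -[RHS]/(map (fun v => gl X Y (tnth (att d) v)) (ord_tuple _)) map_tnth_ord.
pose f : node (hsubst H) -> node (glue X Y) := hlift (H := H) (gl X Y) i.
have fO v : f (onode H v) = gl X Y v := hliftO oi v.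
have fI d v : f (inode H d v) = i d v := hliftI oi v.
have gE : map (onode H) (ext X) = map (inode H None) (ext Y) := fuse_node H None.
apply: (@hisoI _ _ _ _ f (fun x : edge (hsubst H) => match x with
   existT None e => gre X Y e | existT (Some d) _ => gle X Y d end)).
- exists (glift (X := X) (Y := Y) (onode H) (inode H None)).
    elim/hsubst_node_ind => [v|[d|] v]; rewrite ?fO ?fI /= ?(gliftl gE) ?(gliftr gE) //.
    have /map_tuple_eqP/(_ v) := fuse_node H (Some d).
    by rewrite tnth_ord_tuple.
  by elim/glue_ind => v; rewrite ?(gliftl gE) ?(gliftr gE) ?fO ?fI.
- exists (fun x : edge (glue X Y) => match x with
    existT true d => iedge H (Some d) tt | existT false e => iedge H None e end).
    by case=> [[d|] // []].
  by case=> [[]].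
- case=> [[d|] e].
    change (map f (map (inode H (Some d)) (ord_tuple _)) = map (gl X Y) (att d)).
    by rewrite -map_comp (eq_map (fI (Some d))); apply: map_tnth_ord.
  by rewrite /= -!map_comp; apply: eq_map => v /=; rewrite fI.
- by case=> [[d|] // []].
exact: map_tuple0E.
Qed.

End Contexts.

(** * Pushouts along discrete hypergraphs are gluings *)

Section Pushouts.
Variable L : nat -> Type.

Definition setext n k (X : hgraph L n) (t : k.-tuple (node X)) : hgraph L k :=
  {| node := node X; edge := edge X; ar := @ar _ _ X; att := @att _ _ X;
     lab := @lab _ _ X; ext := t |}.

(** The images of the interface nodes become the external nodes. They may repeat, since [l] need not
    be injective. *)
Definition hopen k (A : hgraph L 0) (l : hmorph (dis L k) A) : hgraph L k :=
  setext (map_tuple (fnode l) (ord_tuple k)).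

Definition hcomp n (G H K : hgraph L n) (f : hmorph G H) (g : hmorph H K) :
  hmorph G K.
Proof.
apply: (@Hmorph _ _ _ _ (fnode g \o fnode f) (fedge g \o fedge f)).
- by move=> e; rewrite map_comp !hmorph_att.
- by move=> e; rewrite /= !hmorph_lab.
by rewrite map_comp !hmorph_ext.
Defined.

Definition hid n (G : hgraph L n) : hmorph G G.
Proof. by apply: (@Hmorph _ _ _ _ id id) => [e||]; rewrite ?map_id. Defined.

Lemma pushout_iso n (K A B P P' : hgraph L n) (f : hmorph K A) (g : hmorph K B)
    (a : hmorph A P) (b : hmorph B P) :
    pushout f g a b -> hiso P P' ->
  exists (a' : hmorph A P') (b' : hmorph B P'), pushout f g a' b'.
Proof.
move=> [[sv se] univ] /hisoE[i [j [ijv jiv ije jie]]].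
exists (hcomp a i), (hcomp b i); split.
  by split=> x /=; rewrite ?sv ?se.
move=> X x y /univ[h [[hav hae] [hbv hbe] hU]].
exists (hcomp j h); split; do ?by split=> z /=; rewrite ?ijv ?ije.
move=> h' [av ae] [bv be].
have [] := hU (hcomp i h').
- by split=> z /=; rewrite -?av -?ae.
- by split=> z /=; rewrite -?bv -?be.
move=> uv ue; split=> z /=; first by rewrite -uv /= jiv.
by rewrite -ue /= jie.
Qed.

Lemma pushout_unique n (K A B P P' : hgraph L n) (f : hmorph K A) (g : hmorph K B)
    (a : hmorph A P) (b : hmorph B P) (a' : hmorph A P') (b' : hmorph B P') :
  pushout f g a b -> pushout f g a' b' -> hiso P P'.
Proof.
move=> [sq univ] [sq' univ'].
have [h [[hav hae] [hbv hbe] _]] := univ _ _ _ sq'.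
have [h' [[hav' hae'] [hbv' hbe'] _]] := univ' _ _ _ sq.
(* [u] and [u'] are the unique endomorphisms of [P] and [P'] compatible with the pushout maps. The
   identities and the two composites of [h] and [h'] are compatible too, so they coincide with
   them. *)
have [u [_ _ uU]] := univ _ _ _ sq; have [u' [_ _ uU']] := univ' _ _ _ sq'.
have [idv ide] := uU (hid P) (conj (frefl _) (frefl _)) (conj (frefl _) (frefl _)).
have [idv' ide'] := uU' (hid P') (conj (frefl _) (frefl _)) (conj (frefl _) (frefl _)).
have [cv ce] : fnode (hcomp h h') =1 fnode u /\ fedge (hcomp h h') =1 fedge u.
  by apply: uU; split=> z /=; rewrite ?hav ?hae ?hbv ?hbe ?hav' ?hae' ?hbv' ?hbe'.
have [cv' ce'] : fnode (hcomp h' h) =1 fnode u' /\ fedge (hcomp h' h) =1 fedge u'.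
  by apply: uU'; split=> z /=; rewrite ?hav' ?hae' ?hbv' ?hbe' ?hav ?hae ?hbv ?hbe.
exists h; split.
  by exists (fnode h') => z;
    [exact: etrans (cv z) (esym (idv z)) | exact: etrans (cv' z) (esym (idv' z))].
by exists (fedge h') => z;
  [exact: etrans (ce z) (esym (ide z)) | exact: etrans (ce' z) (esym (ide' z))].
Qed.

(** [Dis_k] has no hyperedges, so a pushout only identifies the two images of each interface node,
    as does gluing the opened hypergraphs. The mediating morphism is given on nodes by [glift]. *)
Lemma glue_pushout k (A B : hgraph L 0) (l : hmorph (dis L k) A)
    (c : hmorph (dis L k) B) (P := glue (hopen c) (hopen l)) :
  exists (a : hmorph A P) (b : hmorph B P), pushout l c a b.
Proof.
pose bv : node B -> node P := gl (hopen c) (hopen l).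
pose be : edge B -> edge P := gle (hopen c) (hopen l).
pose av : node A -> node P := gr (hopen c) (hopen l).
pose ae : edge A -> edge P := gre (hopen c) (hopen l).
have [aa al ax] : [/\ forall e, map av (att e) = att (ae e) :> seq _,
  forall e, Tagged L (lab (ae e)) = Tagged L (lab e) &
  map av (ext A) = ext P :> seq _] by split=> //; apply: map_tuple0E.
have [ba bl bx] : [/\ forall e, map bv (att e) = att (be e) :> seq _,
  forall e, Tagged L (lab (be e)) = Tagged L (lab e) &
  map bv (ext B) = ext P :> seq _] by split=> //; apply: map_tuple0E.
exists (Hmorph aa al ax), (Hmorph ba bl bx); split.
  split=> [v|[]] /=; have := glue_att (hopen c) (hopen l).
  by move/map_tuple_eqP/(_ v); rewrite /= !tnth_map !tnth_ord_tuple => /esym.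
move=> X x y [sv se].
have yx : map (fnode y) (ext (hopen c)) = map (fnode x) (ext (hopen l)).
  by rewrite /= -!map_comp; apply: eq_map => v /=; rewrite sv.
pose hv : node P -> node X :=
  glift (X := hopen c) (Y := hopen l) (fnode y) (fnode x).
have hl v : hv (bv v) = fnode y v := gliftl yx v.
have hr v : hv (av v) = fnode x v := gliftr yx v.
pose he (d : edge P) : edge X :=
  match d with existT true e => fedge y e | existT false e => fedge x e end.
have ha e : map hv (att e) = att (he e) :> seq _.
  by case: e => [[] e] /=; rewrite -hmorph_att -!map_comp; apply: eq_map => v /=;
    rewrite ?hl ?hr.
have hb e : Tagged L (lab (he e)) = Tagged L (lab e).
  by case: e => [[] e] /=; rewrite hmorph_lab.
have hx : map hv (ext P) = ext X :> seq _ by apply: map_tuple0E.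
exists (Hmorph ha hb hx); split; do ?by split.
move=> h' [ahv ahe] [bhv bhe]; split=> /= z.
  elim/glue_ind: z => v; first exact: etrans (bhv v) (esym (hl v)).
  exact: etrans (ahv v) (esym (hr v)).
by case: z => [[] z]; [apply: bhe | apply: ahe].
Qed.

Lemma dpo_applyP (r : dpo_rule L) (G H : hgraph L 0) :
  dpo_apply r G H <->
  exists C, hiso (glue C (hopen (phiL r))) G /\ hiso (glue C (hopen (phiR r))) H.
Proof.
split=> [[C [c [mG [cG [mH [cH [pG pH]]]]]]]|[C [isoG isoH]]].
  exists (hopen c); have [a [b pL]] := glue_pushout (phiL r) c.
  have [a' [b' pR]] := glue_pushout (phiR r) c.
  by split; [apply: pushout_unique pL pG | apply: pushout_unique pR pH].
(* [C] without its external nodes is the DPO context; the leg [c] points to those nodes, so opening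
   [C0] along [c] gives [C] back. *)
pose C0 : hgraph L 0 := setext (X := C) [tuple].
have [ca cl cx] : [/\ forall e : edge (dis L (interface r)),
    map (tnth (ext C)) (att e) = att (of_void (edge C0) e) :> seq (node C0),
  forall e : edge (dis L (interface r)),
    Tagged L (lab (of_void (edge C0) e)) = Tagged L (lab e) &
  map (tnth (ext C)) (ext (dis L (interface r))) = ext C0 :> seq (node C0)].
  by split=> [[]|[]|]; apply: map_tuple0E.
pose c : hmorph (dis L (interface r)) C0 := Hmorph ca cl cx.
have openC : hiso (hopen c) C.
  apply: (@hisoI _ _ (hopen c) C id id) => [||e||].
  - by exists id.
  - by exists id.
  - by rewrite map_id.
  - by [].
  by rewrite map_id [LHS]map_tnth_enum.
have [a [b]] := glue_pushout (phiL r) c.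
move=> /pushout_iso/(_ (hiso_trans (glue_congr openC (hiso_refl _)) isoG)).
case=> mG [cG pG].
have [a' [b']] := glue_pushout (phiR r) c.
move=> /pushout_iso/(_ (hiso_trans (glue_congr openC (hiso_refl _)) isoH)).
case=> mH [cH pH].
by exists C0, c, mG, cG, mH, cH.
Qed.

End Pushouts.

(** * Derivability and its closure under contexts *)

Lemma isolate_edge (L1 L : nat -> Type) n (G : hgraph L1 n)
    (K : forall e : edge G, hgraph L (ar e)) (e0 : edge G) (C : hgraph L n) :
  exists C0 : hgraph L (ar e0), forall K' : forall e : edge G, hgraph L (ar e),
    (forall d, d != e0 -> K' d = K d) ->
    hiso (glue C (hsubst K')) (glue C0 (K' e0)).
Proof.
(* With [e0] in the role of [$], the rest of [G] is a context, which [glue_plug] moves to the side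
   of [C]. The resulting [C0] uses the values of [K] away from [e0] only. *)
pose D : dgraph L1 (ar e0) n :=
  {| dnode := node G; dedge := {d | d != e0}; dar := fun d => ar (val d);
     datt := fun d => att (val d); dlab := fun d => lab (val d);
     dollar := att e0; dext := ext G |}.
exists (plug (D := dflip D) C (fun d => K (val d))) => K' K'E.
apply: (@hiso_trans _ _ _ (glue C (plug (D := D) (K' e0) (fun d => K' (val d))))).
  apply: glue_congr; first exact: hiso_refl.
  pose fe (d : edge (dgraph_full D)) := if d is Some d' then val d' else e0.
  apply/hiso_sym/(@hsubst_congr _ _ _ _ (dgraph_full D) G _ _ id fe).
  - exact: id_bij.
  - exists (fun d => insub d) => [[d|]|d] /=.
    + by rewrite insubT ?(valP d) // => ?; congr Some; apply/val_inj.
    + by rewrite insubF ?eqxx.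
    by case: insubP => [u _ <-//|]; rewrite negbK => /eqP->.
  - by case=> [d|]; rewrite map_id.
  - by rewrite map_id.
  by case=> [d|]; apply/hiso_hheq/hiso_refl.
apply: hiso_trans (glue_plug _ _ _) _.
apply: glue_congr; last exact: hiso_refl.
apply: plug_congr; first exact: hiso_refl.
by move=> d; rewrite K'E ?(valP d) //; apply: hiso_refl.
Qed.

Section Derivability.
Variables (L : nat -> Type) (R : seq (dpo_rule L)).

Definition rstep (G H : hgraph L 0) := exists r, List.In r R /\ dpo_apply r G H.

(** Isomorphisms count as steps, which makes derivability independent of the representatives
    chosen. *)
Definition derives := clos_refl_trans _ (fun G H => hiso G H \/ rstep G H).

Lemma derives_iso G H : hiso G H -> derives G H.
Proof. by move=> GH; apply: rt_step; left. Qed.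

(** By [dpo_applyP] a step absorbs an isomorphism that precedes it, so all isomorphisms can be moved
    to the end of a derivation. *)
Lemma derivesP G H : derives G H <->
  exists2 K, clos_refl_trans _ rstep G K & hiso K H.
Proof.
split=> [|[K GK KH]]; last first.
  apply: rt_trans (derives_iso KH).
  elim: GK => [x y xy|x|x y z _ xy _ yz]; first by apply: rt_step; right.
    exact: rt_refl.
  exact: rt_trans xy yz.
move/(clos_rt_rtn1 _ _ _ _); elim=> [|X Y XY _ [K GK KX]].
  by exists G; [apply: rt_refl | apply: hiso_refl].
case: XY => [XY|[r [rR /dpo_applyP[C [CX CY]]]]].
  by exists K => //; apply: hiso_trans KX XY.
exists Y; last exact: hiso_refl.
apply: rt_trans GK _; apply: rt_step; exists r; split=> //; apply/dpo_applyP.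
by exists C; split=> //; apply: hiso_trans CX (hiso_sym KX).
Qed.

Definition hle n (K K' : hgraph L n) : Prop :=
  forall C, derives (glue C K) (glue C K').

Lemma hle_iso n (K K' : hgraph L n) : hiso K K' -> hle K K'.
Proof. by move=> KK' C; apply/derives_iso/glue_congr => //; apply: hiso_refl. Qed.

Lemma hle_refl n (K : hgraph L n) : hle K K.
Proof. exact/hle_iso/hiso_refl. Qed.

Lemma hle_trans n (K K' K'' : hgraph L n) : hle K K' -> hle K' K'' -> hle K K''.
Proof. by move=> KK' KK'' C; apply: rt_trans (KK' C) (KK'' C). Qed.

Lemma hle_rule r : List.In r R -> hle (hopen (phiL r)) (hopen (phiR r)).
Proof.
move=> rR C; apply: rt_step; right; exists r; split=> //.
by apply/dpo_applyP; exists C; split; apply: hiso_refl.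
Qed.

Lemma hle_derives (K K' : hgraph L 0) : hle K K' -> derives K K'.
Proof.
move=> /(_ (hempty L)) KK'; apply: rt_trans (derives_iso (glue0 K')).
exact: rt_trans (derives_iso (hiso_sym (glue0 K))) KK'.
Qed.

(** A sequential derivation treats the hyperedges of [G] one after the other. *)
Lemma hle_hsubst L1 n (G : hgraph L1 n) (K K' : forall e : edge G, hgraph L (ar e)) :
  (forall e, hle (K e) (K' e)) -> hle (hsubst K) (hsubst K').
Proof.
(* [Z s] is the stage at which the hyperedges in [s] have been treated. *)
move=> KK' C; pose Z (s : seq (edge G)) e := if e \in s then K' e else K e.
have pathZ s : derives (glue C (hsubst K)) (glue C (hsubst (Z s))).
  elim: s => [|e s IHs].
    by apply: derives_iso; apply: glue_congr; apply: hiso_refl.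
  apply: rt_trans IHs _; have [C0 C0E] := isolate_edge (Z s) e C.
  apply: rt_trans (derives_iso (C0E (Z s) (fun _ _ => erefl))) _.
  have ZE d : d != e -> Z (e :: s) d = Z s d.
    by rewrite /Z inE => /negbTE->.
  apply: rt_trans (derives_iso (hiso_sym (C0E _ ZE))).
  by rewrite /Z mem_head; case: ifP => _; [exact: rt_refl | exact: KK'].
apply: rt_trans (pathZ (enum (edge G))) _; apply/derives_iso/glue_congr.
  exact: hiso_refl.
by apply: hsubst_congr_id => e; rewrite /Z mem_enum; apply: hiso_refl.
Qed.

Lemma hle_plug L1 k n (D : dgraph L1 k n) F F' H H' :
    hle F F' -> (forall d, hle (H d) (H' d)) ->
  hle (plug (D := D) F H) (plug (D := D) F' H').
Proof. by move=> FF' HH'; apply: hle_hsubst => -[d|]; [apply: HH'|]. Qed.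

Lemma hle_hsum n (G G' : hgraph L n) X X' :
  hle G G' -> hle X X' -> hle (hsum G X) (hsum G' X').
Proof.
move=> GG' XX'.
apply: hle_trans (hle_iso (hiso_sym (plug_sumctx (tt : (fun=> unit) 0) G X))) _.
apply: hle_trans (hle_iso (plug_sumctx (tt : (fun=> unit) 0) G' X')).
by apply: hle_plug.
Qed.

End Derivability.

(** * The model of upward closed sets *)

Section Model.
Variables (L : nat -> Type) (R : seq (dpo_rule L)).
Variable idx : forall n, L n -> nat.

Local Notation hle := (hle R).

(** [idx] numbers the labels of each rank; [Prim n i] denotes the empty set if [i] is the number of
    no label of rank [n]. *)
Fixpoint model n (A : tp n) : hgraph L n -> Prop :=
  match A in tp n return hgraph L n -> Prop with
  | Prim n i => fun Y => exists2 a : L n, i = idx a & hle (handle a) Y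
  | Div k n N D => fun F => forall H : forall d : dedge D, hgraph L (dar d),
      (forall d, model (dlab d) (H d)) -> model N (plug F H)
  | Times n M => fun Y => exists2 H : forall e : edge M, hgraph L (ar e),
      (forall e, model (lab e) (H e)) & hle (hsubst H) Y
  | Bang A => fun Y => model A (hempty L) /\ hle (hempty L) Y
  end.

(** An antecedent [X] means the same as the type [×(X)], so a sequent [X -> A] is valid when [den X]
    is included in [model A]. *)
Definition den n (X : hgraph tp n) : hgraph L n -> Prop := model (Times X).

(** Transitivity of [hle] settles every clause but that of [Div], where closure is inherited from
    the numerator because plugging is monotone. *)
Lemma model_up n (A : tp n) Y Y' : model A Y -> hle Y Y' -> model A Y'.
Proof.
elim: n / A Y Y' => [n i|k n N IHN D|n M|A _] Y Y' /=.
- by move=> [a iE aY] YY'; exists a => //; apply: hle_trans aY YY'.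
- move=> VY YY' H VH; apply: IHN (VY H VH) _; apply: hle_plug => // d.
  exact: hle_refl.
- by move=> [H VH HY] YY'; exists H => //; apply: hle_trans HY YY'.
by move=> [VA AY] YY'; split=> //; apply: hle_trans AY YY'.
Qed.

Lemma den_up n (X : hgraph tp n) Y Y' : den X Y -> hle Y Y' -> den X Y'.
Proof. exact: (@model_up _ (Times X)). Qed.

Lemma den_handle n (A : tp n) Y : den (handle A) Y <-> model A Y.
Proof.
split=> [[H VH HY]|VY].
  apply: model_up (VH tt) _; apply: hle_trans HY.
  apply: hle_iso; apply: hiso_trans (hiso_sym (hsubst_handle A (H tt))) _.
  by apply: hsubst_congr_id => -[]; apply: hiso_refl.
by exists (fun=> Y) => //; apply/hle_iso/hsubst_handle.
Qed.

(** The meaning is compositional: one direction is associativity of replacement, the other chooses a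
    witness for each hyperedge and uses monotonicity. *)
Lemma den_hsubst L1 n (G : hgraph L1 n) (H : forall e : edge G, hgraph tp (ar e)) Y :
  den (hsubst H) Y <->
  exists2 Z : forall e : edge G, hgraph L (ar e),
    forall e, den (H e) (Z e) & hle (hsubst Z) Y.
Proof.
split=> [[K VK KY]|[Z dZ ZY]].
  exists (fun e => hsubst (fun d => K (iedge H e d))).
    by move=> e; exists (fun d => K (iedge H e d)) => [d|]; [apply: VK | apply: hle_refl].
  by apply: hle_trans KY; apply/hle_iso/hiso_sym/hsubst_assoc.
have {}dZ e : exists K : forall d : edge (H e), hgraph L (ar d),
  (forall d, model (lab d) (K d)) /\ hle (hsubst K) (Z e).
  by have [K] := dZ e; exists K.
have [K KP] := fin_all_exists dZ.
pose K' (x : edge (hsubst H)) : hgraph L (ar x) :=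
  match x with existT e d => K e d end.
exists K'; first by case=> e d; apply: (KP e).1.
apply: hle_trans ZY; apply: hle_trans (hle_iso _ (hsubst_assoc K')) _.
by apply: hle_hsubst => e; apply: (KP e).2.
Qed.

(** Labels matched by an isomorphism are equal only together with their ranks, so a member of the
    model crosses such an equality up to [hheq]. *)
Lemma model_tagged (A B : {n & tp n}) : A = B ->
  forall Y : hgraph L (tag A), model (tagged A) Y ->
  exists K : hgraph L (tag B), model (tagged B) K /\ hheq K Y.
Proof. by move=> <- Y VY; exists Y; split=> //; apply/hiso_hheq/hiso_refl. Qed.

Lemma den_iso n (X X' : hgraph tp n) Y : hiso X X' -> den X Y -> den X' Y.
Proof.
move=> isoX; have [f [bf bfe]] := hiso_sym isoX.
move=> [H VH HY].
have HE e : exists K : hgraph L (ar e), model (lab e) K /\ hheq K (H (fedge f e)).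
  exact: model_tagged (hmorph_lab f e) _ (VH (fedge f e)).
have [K KP] := fin_all_exists HE.
exists K; first by move=> e; apply: (KP e).1.
apply: hle_trans HY; apply: hle_iso.
apply: hsubst_congr bf bfe _ _ _.
- exact: hmorph_att.
- exact: hmorph_ext.
by move=> e; apply: (KP e).2.
Qed.

End Model.

(** * Soundness of the calculus in the model *)

Section Soundness.
Variables (L : nat -> Type) (R : seq (dpo_rule L)).
Variable idx : forall n, L n -> nat.

Local Notation hle := (hle R).
Local Notation model := (model R idx).
Local Notation den := (den R idx).

(** The left rules for [÷] and [×] change the antecedent at one hyperedge; this reduces their
    validity to an inclusion at that place. *)
Lemma den_hrepl n (G : hgraph tp n) (e : edge G) (X X' : hgraph tp (ar e)) Y :
  (forall Z, den X Z -> den X' Z) -> den (hrepl e X) Y -> den (hrepl e X') Y.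
Proof.
move=> XX' /den_hsubst[Z dZ ZY]; apply/den_hsubst; exists Z => // d.
have [dE|dN] := eqVneq d e; last by move: (dZ d); rewrite !dfwith_out // eq_sym.
by subst d; move: (dZ e); rewrite !dfwith_in; apply: XX'.
Qed.

Lemma den_plug L1 k n (D : dgraph L1 k n) F H Y :
  den (plug (D := D) F H) Y <-> exists Z0 Z,
    [/\ den F Z0, forall d, den (H d) (Z d) & hle (plug (D := D) Z0 Z) Y].
Proof.
split=> [/den_hsubst[Z dZ ZY]|[Z0 [Z [dF dH ZY]]]]; last first.
  by apply/den_hsubst; exists (plugfam Z0 Z) => // -[d|] //=; apply: dH.
exists (Z None), (fun d => Z (Some d)); split=> [|d|].
- exact: (dZ None).
- exact: (dZ (Some d)).
apply: hle_trans ZY; apply: hle_hsubst => -[d|]; exact: hle_refl.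
Qed.

Lemma den_hsum n (G : hgraph tp n) X Y :
  den (hsum G X) Y <-> exists Y1 Y2, [/\ den G Y1, den X Y2 & hle (hsum Y1 Y2) Y].
Proof.
split=> [/(den_iso (hiso_sym (plug_sumctx (tt : (fun=> unit) 0) G X)))|].
  case/den_plug=> Y1 [Z [dG dX ZY]]; exists Y1, (Z tt); split=> //.
    exact: (dX tt).
  apply: hle_trans ZY; apply: hle_iso.
  apply: hiso_trans (hiso_sym (plug_sumctx (tt : (fun=> unit) 0) _ _)) _.
  by apply: plug_congr => [|[]]; apply: hiso_refl.
move=> [Y1 [Y2 [dG dX ZY]]].
apply/(den_iso (plug_sumctx (tt : (fun=> unit) 0) G X))/den_plug.
exists Y1, (fun=> Y2); split=> //; apply: hle_trans ZY.
exact: hle_iso (plug_sumctx _ _ _).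
Qed.

(** A summand [!A] can only denote hypergraphs above [0], so it grows from nothing and leaves just
    the condition that [0] is in the model of [A]. Weakening and contraction follow at once. *)
Lemma den_hsum_bang n (G : hgraph tp n) A Y :
  den (hsum G (handle (Bang A))) Y <-> model A (hempty L) /\ den G Y.
Proof.
split=> [/den_hsum[Y1 [Y2 [dG /den_handle[VA Y2E] YE]]]|[VA dG]].
  split=> //; apply: den_up dG _; apply: hle_trans YE.
  apply: hle_trans (hle_iso _ (hiso_sym (hsum0 Y1))) _.
  by apply: hle_hsum => //; apply: hle_refl.
apply/den_hsum; exists Y, (hempty L); split=> //; last exact/hle_iso/hsum0.
by apply/den_handle; split=> //; apply: hle_refl.
Qed.

(** If a sum of banged types denotes anything, it denotes [0] and otherwise only hypergraphs above
    [0]. For promotion, the induction hypothesis is then applied at [0]. *)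
Lemma den_bangs As Y : den (bangs As) Y -> den (bangs As) (hempty L) /\ hle (hempty L) Y.
Proof.
elim: As Y => [|A As IHAs] Y /=; last first.
  by move=> /den_hsum_bang[VA /IHAs[d0 dY]]; split=> //; apply/den_hsum_bang.
have dis0 (H : forall e : edge (hempty tp), hgraph L (ar e)) :
    hiso (hsubst H) (hempty L).
  have F (v : node (hempty tp)) : False by case: (v).
  have F' (v : node (hsubst H)) : False.
    by elim/hsubst_node_ind: v => [v|[]]; apply: F.
  apply: (@hisoI _ _ _ (hempty L) (fun v => False_rect _ (F' v))
    (fun e : edge (hsubst H) => match tag e : void with end)).
  - by exists (fun v => False_rect _ (F v)) => v; [case: (F' v) | case: (F v)].
  - by exists (of_void _) => [[[]]|[]].
  - by case=> [[]].
  - by case=> [[]].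
  exact: map_tuple0E.
case=> H VH HY; split; last exact: hle_trans (hle_iso _ (hiso_sym (dis0 H))) HY.
by exists H => //; apply/hle_iso/dis0.
Qed.

Lemma hmel0_sound n (G : hgraph tp n) (A : tp n) :
  hmel0 G A -> forall Y, den G Y -> model A Y.
Proof.
elim=> {n G A}.
- by move=> n G H A GH _ IH Y dH; apply: IH; apply: den_iso (hiso_sym GH) dH.
- by move=> n A Y /den_handle.
(* For [÷] on the left, [Z] lies above a plugging of some [F] in the model of [N ÷ D]; by the clause
   for [Div] that plugging is in the model of [N]. *)
- move=> n G e B k N D H _ IH _ IHH Y dY; apply: IH.
  apply: den_hrepl dY => Z /den_plug[F [K [/den_handle VF dK KZ]]].
  apply/den_handle; apply: model_up KZ; apply: VF => d; exact: IHH.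
- move=> k n F N D _ IH Y dY H VH; apply: IH; apply/den_plug.
  exists Y, H; split=> // [d|]; last exact: hle_refl.
  by apply/den_handle; apply: VH.
- move=> n G e B M _ IH Y dY; apply: IH; apply: den_hrepl dY => Z.
  by move/den_handle.
- move=> n M H _ IH Y /den_hsubst[Z dZ ZY]; exists Z => // m; exact: IH.
(* For dereliction, [0] stands for the summand [A], and [Y + 0] is isomorphic to [Y]. *)
- move=> n G A B _ IH Y /den_hsum_bang[VA dG]; apply: IH; apply/den_hsum.
  exists Y, (hempty L); split=> //; last exact/hle_iso/hsum0.
  exact/den_handle.
- move=> As B _ IH Y /den_bangs[d0 dY]; split=> //; exact: IH.
- by move=> n G A B _ IH Y /den_hsum_bang[_ /IH].
by move=> n G A B _ IH Y dY; apply: IH; have [VA _] := iffLR (den_hsum_bang _ _ _) dY;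
  apply/den_hsum_bang.
Qed.

End Soundness.

(** * The denominators [$ + R] of rule types, and relabelling *)

Section NullaryHole.
Variables (L1 L : nat -> Type) (k : nat) (X : hgraph L1 k).

(** The context [$ + X] with a hole of rank 0: whatever is plugged in remains a disjoint summand. *)
Definition nullary_hole : dgraph L1 0 k :=
  {| dnode := node X; dedge := edge X; dar := @ar _ _ X; datt := @att _ _ X;
     dlab := @lab _ _ X; dollar := [tuple]; dext := ext X |}.

Lemma plug_nullary_hole (F : hgraph L 0) (K : forall e : edge X, hgraph L (ar e)) :
  hiso (plug (D := nullary_hole) F K) (hsum (hsubst K) F).
Proof.
pose Q := hsum (hsubst K) F; set H := plugfam (D := nullary_hole) F K.
pose o (v : node X) : node Q := inl (onode K v).
pose i (d : edge (dgraph_full nullary_hole)) : node (H d) -> node Q :=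
  match d with Some e => fun v => inl (inode K e v) | None => inr end.
have oi (d : edge (dgraph_full nullary_hole)) :
    map o (att d) = map (i d) (ext (H d)).
  case: d => [d|]; last exact: map_tuple0.
  by rewrite [LHS](map_comp inl) (fuse_node K) -map_comp.
pose f : node (hsubst H) -> node Q := hlift (H := H) o i.
have fO v : f (onode H v) = inl (onode K v) := hliftO oi v.
have fI d v : f (inode H d v) = i d v := hliftI oi v.
have gE (e : edge X) : map (onode H) (att e) = map (inode H (Some e)) (ext (K e)).
  exact: (fuse_node H (Some e)).
pose h : node (hsubst K) -> node (hsubst H) :=
  hlift (H := K) (onode H) (fun e => inode H (Some e)).
have hO v : h (onode K v) = onode H v := hliftO gE v.
have hI e v : h (inode K e v) = inode H (Some e) v := hliftI gE v.
apply: (@hisoI _ _ (hsubst H) Q f (fun x : edge (hsubst H) => match x with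
   existT None e => inr e | existT (Some d) e => inl (iedge K d e) end)).
- exists (fun v : node Q =>
    match v with inl v => h v | inr v => inode H None v end).
    by elim/hsubst_node_ind => [v|[d|] v]; rewrite ?fO ?fI /= ?hO ?hI.
  case=> [|v]; last by rewrite fI.
  by elim/hsubst_node_ind => [v|d v]; rewrite ?hO ?hI ?fO ?fI.
- exists (fun x : edge Q => match x with
    inl (existT d e) => iedge H (Some d) e | inr e => iedge H None e end).
    by case=> [[d|] e].
  by case=> [[]|].
- by case=> [[d|] e] /=; rewrite -!map_comp; apply: eq_map => v /=; rewrite fI.
- by case=> [[d|] e].
by rewrite /= -!map_comp; apply: eq_map => v /=; rewrite fO.
Qed.

End NullaryHole.

Section Relabelling.
Variables (L L' : nat -> Type) (p : forall n, L n -> L' n).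

Definition relab n (X : hgraph L n) : hgraph L' n := hrelab (fun e : edge X => p (lab e)).

Lemma relab_iso n (X X' : hgraph L n) : hiso X X' -> hiso (relab X) (relab X').
Proof.
case=> f [bf bfe].
apply: (@hisoI _ _ (relab X) (relab X') (fnode f) (fedge f)) => //.
- exact: (hmorph_att f).
- move=> e; have := congr1 (fun x => Tagged L' (p (tagged x))) (hmorph_lab f e).
  exact.
exact: (hmorph_ext f).
Qed.

(** Fusion does not look at labels, so identity maps carry the relabelling inside the gluing. *)
Lemma relab_glue n (X Y : hgraph L n) :
  hiso (relab (glue X Y)) (glue (relab X) (relab Y)).
Proof.
pose H (b : edge (pairctx n)) : hgraph L' (ar b) := relab (pairfam X Y b).
apply: (@hiso_trans _ _ _ (hsubst H)); last first.
  by apply: hsubst_congr_id => -[]; apply: hiso_refl.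
apply: (@hisoI _ _ (relab (glue X Y)) (hsubst H) id id).
- exact: id_bij.
- exact: id_bij.
- by move=> e; rewrite map_id; apply: eq_map => v; apply/val_inj.
- by [].
exact: map_tuple0E.
Qed.

End Relabelling.

(** * Completeness: sequent derivations from DPO derivations *)

Section Derivations.

Definition addbangs n (F : hgraph tp n) (As : seq (tp 0)) : hgraph tp n :=
  foldr (fun A G => hsum G (handle (Bang A))) F As.

Lemma addbangs_hsum n (F : hgraph tp n) X As :
  hiso (addbangs (hsum F X) As) (hsum (addbangs F As) X).
Proof.
elim: As => [|A As IHAs] /=; first exact: hiso_refl.
exact: hiso_trans (hsum_congr IHAs (hiso_refl _)) (hsum_swap _ _ _).
Qed.

Lemma addbangs_iso n (F F' : hgraph tp n) As :
  hiso F F' -> hiso (addbangs F As) (addbangs F' As).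
Proof. by move=> FF'; elim: As => //= A As /hsum_congr; apply; apply: hiso_refl. Qed.

Lemma addbangs_in n (F : hgraph tp n) A As : List.In A As ->
  exists As', hiso (addbangs F As) (hsum (addbangs F As') (handle (Bang A))).
Proof.
elim: As => //= B As IHAs [->|/IHAs[As' isoAs]].
  by exists As; apply: hiso_refl.
exists (B :: As') => /=.
exact: hiso_trans (hsum_congr isoAs (hiso_refl _)) (hsum_swap _ _ _).
Qed.

Lemma glue_addbangs n (X Y : hgraph tp n) As :
  hiso (glue (addbangs X As) Y) (addbangs (glue X Y) As).
Proof.
elim: As => [|A As IHAs] /=; first exact: hiso_refl.
apply: hiso_trans (glueC _ _) _; apply: hiso_trans (glue_hsum _ _ _) _.
apply: hsum_congr (hiso_refl _).
exact: hiso_trans (glueC _ _) IHAs.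
Qed.

(** Read from bottom to top, contraction duplicates [!A] and dereliction opens one of the copies. *)
Lemma addbangs_use n (F : hgraph tp n) A As B : List.In A As ->
  hmel0 (hsum (addbangs F As) (handle A)) B -> hmel0 (addbangs F As) B.
Proof.
move=> /(addbangs_in F)[As' isoAs] /Hmel0_dereliction FB.
apply: Hmel0_iso (hiso_sym isoAs) _; apply: Hmel0_contraction.
exact: Hmel0_iso (hsum_congr isoAs (hiso_refl _)) FB.
Qed.

Lemma addbangs_weaken n (F : hgraph tp n) As B :
  hmel0 F B -> hmel0 (addbangs F As) B.
Proof. by move=> FB; elim: As => //= A As; apply: Hmel0_weakening. Qed.

Lemma times_refl n (M : hgraph tp n) : hmel0 M (Times M).
Proof.
apply: Hmel0_iso (hsubst_handles M) _; apply: Hmel0_times_r => m.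
exact: Hmel0_ax.
Qed.

Definition goal_type (N : tp 0) (As : seq (tp 0)) : tp 0 :=
  foldr (fun A M => Div M (sumctx 0 (Bang A))) N As.

Lemma goal_type_r (F : hgraph tp 0) N As :
  hmel0 (addbangs F As) N -> hmel0 F (goal_type N As).
Proof.
elim: As F => //= A As IHAs F FN; apply: Hmel0_div_r.
apply: Hmel0_iso (hiso_sym (plug_sumctx (Bang A) F (handle (Bang A)))) _.
by apply: IHAs; apply: Hmel0_iso (hiso_sym (addbangs_hsum _ _ _)) FN.
Qed.

(** The label [Prim k 0] is immaterial. *)
Definition close k (X : hgraph tp k) : hgraph tp 0 :=
  let cl_ar (d : option (edge X)) := if d is Some e then ar e else k in
  {| node := node X; edge := option (edge X); ar := cl_ar;
     att := fun d => match d return (cl_ar d).-tuple _ with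
       | Some e => att e | None => ext X end;
     lab := fun d => match d return tp (cl_ar d) with
       | Some e => lab e | None => Prim k 0 end;
     ext := [tuple] |}.

(** This brings gluings into the form [hrepl] on which the left rules act. *)
Lemma close_glue k (X Y : hgraph tp k) :
  hiso (@hrepl _ _ (close X) None Y) (glue X Y).
Proof.
apply: hiso_trans (plug_hole X Y).
apply: (@hsubst_congr _ _ _ _ (close X) (dgraph_full (hole X)) _ _ id id).
- exact: id_bij.
- exact: id_bij.
- by case=> [d|]; rewrite map_id.
- by rewrite map_id.
case=> [d|]; last by rewrite dfwith_in; apply/hiso_hheq/hiso_refl.
by rewrite dfwith_out //; apply/hiso_hheq/hiso_refl.
Qed.

Lemma glue_times_l k (X M : hgraph tp k) B :
  hmel0 (glue X M) B -> hmel0 (glue X (handle (Times M))) B.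
Proof.
move=> /(Hmel0_iso (hiso_sym (close_glue X M))) XM.
exact: Hmel0_iso (close_glue _ _) (Hmel0_times_l XM).
Qed.

Lemma glue_div_l k j (X : hgraph tp k) (N : tp k) (D : dgraph tp j k) B :
    hmel0 (glue X (handle N)) B ->
  hmel0 (glue X (plug (D := D) (handle (Div N D)) (fun d => handle (dlab d)))) B.
Proof.
move=> /(Hmel0_iso (hiso_sym (close_glue X (handle N)))) XN.
apply: Hmel0_iso (close_glue _ _) _.
apply: (@Hmel0_div_l 0 (close X) None B j N D) XN _ => d; exact: Hmel0_ax.
Qed.

Variables (L : nat -> Type) (p : forall n, L n -> tp n).

Definition rule_type (r : dpo_rule L) : tp 0 :=
  Div (Times (relab p (hopen (phiL r)))) (nullary_hole (relab p (hopen (phiR r)))).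

(** Read from bottom to top: a copy of [rule_type r] is opened, [÷] on the left consumes it together
    with the right-hand side of [r], and [×] on the left unfolds what remains into the left-hand
    side. *)
Lemma rule_step (R : seq (dpo_rule L)) K K' B :
    rstep R K K' ->
    hmel0 (addbangs (relab p K) (List.map rule_type R)) B ->
  hmel0 (addbangs (relab p K') (List.map rule_type R)) B.
Proof.
case=> r [rR /dpo_applyP[C [CK CK']]]; set As := List.map _ _ => KB.
have AsE Y Z : hiso (glue C Y) Z ->
    hiso (addbangs (relab p Z) As) (glue (addbangs (relab p C) As) (relab p Y)).
  move=> CYZ; apply: hiso_trans (hiso_sym (glue_addbangs _ _ _)).
  apply: addbangs_iso; apply: hiso_trans (relab_glue _ _ _).
  exact/relab_iso/hiso_sym.
apply: (@addbangs_use _ _ (rule_type r)); first exact: List.in_map.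
have /glue_times_l/(glue_div_l (nullary_hole (relab p (hopen (phiR r))))) :=
  Hmel0_iso (AsE _ _ CK) KB.
apply: Hmel0_iso.
apply: hiso_trans (hsum_congr (hiso_sym (AsE _ _ CK')) (hiso_refl _)).
(* The summand [rule_type r] is moved into the part glued to [C], next to the right-hand side. *)
apply: hiso_trans (glue_hsum _ _ _); apply: glue_congr (hiso_refl _) _.
apply: hiso_trans (plug_nullary_hole _ _) _.
exact: hsum_congr (hsubst_handles _) (hiso_refl _).
Qed.

Lemma grammar_complete (R : seq (dpo_rule L)) (S K : hgraph L 0) :
    clos_refl_trans _ (rstep R) S K ->
  hmel0 (relab p K) (goal_type (Times (relab p S)) (List.map rule_type R)).
Proof.
move=> SK; apply: goal_type_r.
(* The last DPO step is the lowest in the sequent derivation. With no step left, all banged types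
   are weakened away. *)
elim: (clos_rt_rtn1 _ _ _ _ SK) => [|Y Z YZ _]; last exact: rule_step.
exact/addbangs_weaken/times_refl.
Qed.

End Derivations.

(** * Soundness of the grammar, and equality of the languages *)

Section LanguageInclusion.
Variables (L : nat -> Type) (R : seq (dpo_rule L)).
Variable idx : forall n, L n -> nat.
Hypothesis idx_inj : forall n, injective (@idx n).

Local Notation hle := (hle R).
Local Notation model := (model R idx).
Local Notation prim := (fun n (a : L n) => Prim n (idx a)).

(** Injectivity of [idx] leaves [a] as the only label behind this type. *)
Lemma model_prim n (a : L n) Y : model (Prim n (idx a)) Y <-> hle (handle a) Y.
Proof. by split=> [[b /idx_inj->]|aY] //; exists a. Qed.

Lemma hsubst_relab n (X : hgraph L n) (H : forall e : edge X, hgraph L (ar e)) :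
  hiso (hsubst (G := X) H) (hsubst (G := relab prim X) H).
Proof.
apply: (@hsubst_congr _ _ _ _ X (relab prim X) _ _ id id).
- exact: id_bij.
- exact: id_bij.
- by move=> e; rewrite map_id.
- by rewrite map_id.
by move=> e; apply/hiso_hheq/hiso_refl.
Qed.

(** Handles are the least hypergraphs that may replace the hyperedges, and replacing by them gives
    [X] itself. *)
Lemma model_relab n (X : hgraph L n) Y : model (Times (relab prim X)) Y <-> hle X Y.
Proof.
split=> [[H VH HY]|XY].
  apply: hle_trans HY; apply: hle_trans (hle_iso _ (hsubst_relab H)).
  apply: hle_trans (hle_iso _ (hiso_sym (hsubst_handles X))) _.
  by apply: hle_hsubst => e; apply/model_prim/(VH e).
exists (fun e => handle (@lab _ _ X e)); first by move=> e; apply/model_prim/hle_refl.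
apply: hle_trans XY; apply: hle_iso.
exact: hiso_trans (hiso_sym (hsubst_relab _)) (hsubst_handles X).
Qed.

(** Plugging [0] into the denominator leaves the right-hand side with its hyperedges replaced by
    members of the model. This lies above the right-hand side, hence above the left-hand side. *)
Lemma model_rule_type r : List.In r R -> model (rule_type prim r) (hempty L).
Proof.
move=> rR H VH; apply/model_relab; apply: hle_trans (hle_rule rR) _.
apply: hle_trans (hle_iso _ (hiso_sym (plug_nullary_hole (hempty L) H))).
apply: hle_trans (hle_iso _ (hiso_sym (hsum0 _))).
apply/model_relab; exists H => //; exact: hle_refl.
Qed.

(** Each division by [$ + !A] is discharged by taking [0] as the member of the model of [!A]. *)
Lemma model_goal_type N As F : (forall A, List.In A As -> model A (hempty L)) ->
  model (goal_type N As) F -> model N F.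
Proof.
elim: As F => //= A As IHAs F VAs /(_ (fun=> hempty L)) VF.
have {}VF : model (goal_type N As) F.
  apply: model_up (VF _) _; last first.
    exact: hle_iso (hiso_trans (plug_sumctx (Bang A) _ _) (hsum0 _)).
  by move=> _; split; [apply: VAs; left | apply: hle_refl].
by apply: IHAs VF => B BAs; apply: VAs; right.
Qed.

Lemma grammar_sound (S K : hgraph L 0) :
    hmel0 (relab prim K)
      (goal_type (Times (relab prim S)) (List.map (rule_type prim) R)) ->
  exists2 K', clos_refl_trans _ (rstep R) S K' & hiso K' K.
Proof.
(* Soundness is applied at [K] itself, which belongs to the meaning of its own relabelling. The
   result is that [S] lies below [K], and the empty context turns this into a derivation. *)
move=> /hmel0_sound KS; apply/derivesP/hle_derives/model_relab.
apply: model_goal_type (KS _ R idx K _); last exact/model_relab/hle_refl.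
by move=> A /List.in_map_iff[r [<- rR]]; apply: model_rule_type.
Qed.

End LanguageInclusion.

Theorem theorem2 (T : alphabet) (HGr : dpo_grammar T) :
  exists Gr : hmel0_grammar T,
    forall (n : nat) (G : hgraph (label T) n),
      hmel0_language Gr G <-> dpo_language HGr G.
Proof.
pose L := label (alphabet_sum (nonterminal HGr) T).
(* Nonterminals get primitive types too; the position of a symbol in the finite sum alphabet keeps
   these types distinct. *)
pose idx n (a : L n) : nat := enum_rank (sval a).
have idx_inj n : injective (@idx n).
  by move=> a b /val_inj/enum_rank_inj/val_inj.
pose prim n (a : L n) := Prim n (idx n a).
pose goal := goal_type (Times (relab prim (start HGr)))
  (List.map (rule_type prim) (rules HGr)).
exists {| lexicon := fun n (a : label T n) => [:: prim n (label_inr _ a)];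
          goal := goal |} => n G.
split; last first.
  case=> {n} G K SK KG.
  apply: (@Hmel0Language _ {| goal := goal |} _
    (fun e => prim _ (label_inr _ (lab e)))); first by left.
  apply: Hmel0_iso (relab_iso prim KG) _; exact: grammar_complete SK.
case=> {n} G f fE fG.
have [K SK KG] : exists2 K, clos_refl_trans _ (rstep (rules HGr)) (start HGr) K &
    hiso K (hrelab (fun e : edge G => label_inr (nonterminal HGr) (lab e))).
  apply: (grammar_sound idx_inj); apply: Hmel0_iso fG.
  apply: (@hisoI _ _ (hrelab f) (relab prim (hrelab _)) id id).
  - exact: id_bij.
  - exact: id_bij.
  - by move=> e; rewrite map_id.
  (* The lexicon offers a single type for each label, so the type relabelling is forced. *)
  - by move=> e /=; have [->|[]] := fE e.
  by rewrite map_id.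
exact: DpoLanguage SK KG.
Qed.
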